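(* Let $N\ge1$ be an integer, $c\in\mathbb{C}$, $\alpha_1,\dots,\alpha_N\in[0,2\pi)$, and let $s_1,\dots,s_N$ be real numbers with $s_k\ge1$ for all $k$. Let $$f(z)=c\prod_{k=1}^N(z-e^{i\alpha_k})^{s_k},\qquad z\in\mathbb{D},$$ where the branches are chosen so that $f$ is analytic in $\mathbb{D}$. Then $$\|f'\|_{\mathbb{T}}=\frac{\sum_{k=1}^Ns_k}{2}\,\|f\|_{\mathbb{T}}.$$
   Context: $\mathbb{D}$ is the open unit disk, $\mathbb{T}$ the unit circle, and $\|g\|_{\mathbb{T}}=\sup_{z\in\mathbb{T}}|g(z)|$. Under the hypotheses both $f$ and $f'$ extend continuously from $\mathbb{D}$ to $\overline{\mathbb{D}}$, and the norms on $\mathbb{T}$ are those of these continuous extensions. *)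

(* Defs.v *)
From HB Require Import structures.
From mathcomp Require Import all_boot all_order all_algebra.
From mathcomp Require Import all_classical all_reals all_analysis.
From mathcomp Require Import complex.

Set Implicit Arguments.
Unset Strict Implicit.
Unset Printing Implicit Defensive.
Import Order.TTheory GRing.Theory Num.Theory.
Import numFieldTopology.Exports numFieldNormedType.Exports.
Local Open Scope classical_set_scope.
Local Open Scope ring_scope.
Local Open Scope complex_scope.

Definition cexp (R : realType) (z : R[i]) : R[i] :=
  (expR (complex.Re z) * cos (complex.Im z))
    +i* (expR (complex.Re z) * sin (complex.Im z)).

(* The values of the multivalued power w^s: all exp (s * l) with l a logarithm
   of w.  The set is empty when w = 0. *)
Definition cpow_values (R : realType) (w : R[i]) (s : R) : set R[i] :=
  [set cexp (s%:C * l) | l in [set l | cexp l = w]].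

Definition open_disk (R : realType) : set R[i] := [set z | `|z| < 1].
Definition closed_disk (R : realType) : set R[i] := [set z | `|z| <= 1].
Definition unit_circle (R : realType) : set R[i] := [set z | `|z| = 1].

(* The regular module R[i]^o carries the norm topology of the field R[i], as a
   normed module over R[i] itself: its derivatives are complex derivatives. *)
Definition analytic_on (R : realType) (A : set R[i]) (f : R[i] -> R[i]) : Prop :=
  forall z, A z -> derivable (f : R[i]^o -> R[i]^o) z 1.

Definition cderiv (R : realType) (f : R[i] -> R[i]) : R[i] -> R[i] :=
  derive1 (f : R[i] -> R[i]^o).

Definition continuous_extension (R : realType) (f F : R[i] -> R[i]) : Prop :=
  (forall z, open_disk z -> F z = f z) /\
  {within (@closed_disk R : set (R[i]^o)), continuous (F : R[i]^o -> R[i]^o)}.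

(* The norm on R[i] takes its values in R[i], hence the real part. *)
Definition sup_norm (R : realType) (A : set R[i]) (g : R[i] -> R[i]) : R :=
  sup [set complex.Re `|g z| | z in A].

(* Main.v *)
(* Write [a_k = e^{i alpha_k}], [S = \sum_k s_k] and [L = z f'/f = \sum_k s_k z/(z - a_k)].
   On the circle [Re (z/(z - a_k)) = 1/2], so [Re L = S/2] and [|f'| >= (S/2) |f|].
   For the converse bound take [sigma > S] and [k = sigma f - z f' = f (sigma - L)]; on
   the circle [|f'| <= |k|]. The maximum of [|k|] on the closed disk is attained at some
   [z0] with [|z0| = 1], where [z0 k'(z0)/k(z0)] must be real and nonnegative. Since
   [z k'/k = L - z L'/(sigma - L)] and [z L'] is real on the circle, either [L(z0)] is real,
   and then [|k(z0)| = (sigma - S/2) |f(z0)|], or the real part of [z0 k'(z0)/k(z0)] is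
   [S - sigma < 0], which is impossible; a simple zero of [f] gives [S - sigma] as well.
   Let [sigma] tend to [S].

   No branch of the powers is ever chosen: [|f| = |c| \prod_k |z - a_k|^{s_k}] together
   with analyticity already determines [f'/f] and the continuous extensions. *)
Require Import Defs.
From HB Require Import structures.
From mathcomp Require Import all_boot all_order all_algebra.
From mathcomp Require Import all_classical all_reals all_analysis.
From mathcomp Require Import complex ring lra.

Set Implicit Arguments.
Unset Strict Implicit.
Unset Printing Implicit Defensive.
Import Order.TTheory GRing.Theory Num.Theory.
Import numFieldTopology.Exports numFieldNormedType.Exports.
Local Open Scope classical_set_scope.
Local Open Scope ring_scope.
Local Open Scope complex_scope.

(** * Real-valued modulus, real and imaginary parts, and limits in [R[i]] *)

Section ComplexNorm.
Variable R : realType.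
Implicit Types z w : R[i].
Local Notation normc := (@Normc.normc R).

Lemma normc_ge0 z : 0 <= normc z.
Proof. by case: z => a b /=; exact: sqrtr_ge0. Qed.

Lemma normcD_le z w : normc (z + w) <= normc z + normc w.
Proof. by have := ler_normD z w; rewrite -lecR rmorphD. Qed.

Lemma normcBC z w : normc (z - w) = normc (w - z).
Proof. by apply: (@complexI R); exact: (distrC z w). Qed.

Lemma normc_sum (I : Type) (r : seq I) (F : I -> R[i]) :
  normc (\sum_(i <- r) F i) <= \sum_(i <- r) normc (F i).
Proof.
elim/big_ind2 : _ => [|x1 x2 y1 y2 h1 h2|//]; first by rewrite Normc.normc0.
by rewrite (le_trans (normcD_le _ _))// lerD.
Qed.

Lemma normc_prod (I : Type) (r : seq I) (P : pred I) (F : I -> R[i]) :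
  normc (\prod_(i <- r | P i) F i) = \prod_(i <- r | P i) normc (F i).
Proof. by rewrite (big_morph _ (@Normc.normcM R) (@Normc.normc1 R)). Qed.

Lemma normc_dist z w : `|normc z - normc w| <= normc (z - w).
Proof.
have := ler_dist_dist z w.
by rewrite -lecR; congr (_ <= _);
  rewrite -rmorphB /= normc_def/= expr0n/= addr0 sqrtr_sqr.
Qed.

Lemma sqr_normcE z : normc z ^+ 2 = complex.Re z ^+ 2 + complex.Im z ^+ 2.
Proof. by case: z => a b /=; rewrite sqr_sqrtr// addr_ge0// sqr_ge0. Qed.

Lemma normc_real (x : R) : normc x%:C = `|x|.
Proof. by rewrite /= expr0n/= addr0 sqrtr_sqr. Qed.

Lemma Re_le_normc z : `|complex.Re z| <= normc z.
Proof. by rewrite -lecR; exact: normc_ge_Re. Qed.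

Lemma Im_le_normc z : `|complex.Im z| <= normc z.
Proof.
rewrite -(ler_pXn2r (_ : 0 < 2)%N) ?nnegrE ?normc_ge0// sqr_normcE.
by rewrite real_normK ?num_real// lerDr sqr_ge0.
Qed.

Lemma normc_le_ReIm z : normc z <= `|complex.Re z| + `|complex.Im z|.
Proof.
rewrite -(ler_pXn2r (_ : 0 < 2)%N) ?nnegrE ?normc_ge0 ?addr_ge0// sqr_normcE.
rewrite sqrrD !real_normK ?num_real// -addrA [_ *+ 2 + _]addrC addrA lerDl.
by rewrite mulrn_wge0 ?mulr_ge0.
Qed.

Lemma normc_eq0 z : (normc z == 0) = (z == 0).
Proof.
by apply/eqP/eqP => [/Normc.eq0_normc//|->]; exact: Normc.normc0.
Qed.

Lemma normc_gt0 z : (0 < normc z) = (z != 0).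
Proof. by rewrite lt_neqAle normc_ge0 andbT eq_sym normc_eq0. Qed.

Lemma normc_lt1 z : open_disk z = (normc z < 1).
Proof. by rewrite -ltcR. Qed.

Lemma normc_le1 z : closed_disk z = (normc z <= 1).
Proof. by rewrite -lecR. Qed.

Lemma normc_eq1 z : unit_circle z <-> normc z = 1.
Proof.
rewrite /unit_circle/=; split => [/(congr1 (@complex.Re R))//|h].
by rewrite -[1]/(1%:C) -h.
Qed.

Lemma conj_normc z : z * z^* = (normc z ^+ 2)%:C.
Proof. by rewrite -sqr_normc rmorphXn. Qed.

Lemma normc_conj z : normc z^* = normc z.
Proof. by case: z => a b /=; rewrite sqrrN. Qed.

Lemma ReD z w : complex.Re (z + w) = complex.Re z + complex.Re w.
Proof. by case: z; case: w. Qed.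

Lemma ReB z w : complex.Re (z - w) = complex.Re z - complex.Re w.
Proof. by case: z; case: w. Qed.

Lemma ImD z w : complex.Im (z + w) = complex.Im z + complex.Im w.
Proof. by case: z; case: w. Qed.

Lemma ImB z w : complex.Im (z - w) = complex.Im z - complex.Im w.
Proof. by case: z; case: w. Qed.

Lemma ReM z w : complex.Re (z * w) =
  complex.Re z * complex.Re w - complex.Im z * complex.Im w.
Proof. by case: z; case: w. Qed.

Lemma ImM z w : complex.Im (z * w) =
  complex.Re z * complex.Im w + complex.Im z * complex.Re w.
Proof. by case: z; case: w. Qed.

Lemma ReZ (x : R) z : complex.Re (x%:C * z) = x * complex.Re z.
Proof. by rewrite ReM/= mul0r subr0. Qed.

Lemma ImZ (x : R) z : complex.Im (x%:C * z) = x * complex.Im z.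
Proof. by rewrite ImM/= mul0r addr0. Qed.

Lemma Re_sum (I : Type) (r : seq I) (P : pred I) (F : I -> R[i]) :
  complex.Re (\sum_(i <- r | P i) F i) = \sum_(i <- r | P i) complex.Re (F i).
Proof. exact: (big_morph _ ReD). Qed.

(** The radii of balls in [R[i]] are themselves elements of [R[i]]. A positive element of [R[i]] is
    real, so real radii suffice. *)
Lemma nbhsC (z : R[i]^o) (P : set R[i]^o) :
  nbhs z P <-> exists2 e : R, 0 < e & forall w, normc (w - z) < e -> P w.
Proof.
rewrite nbhs_ballP; split => [[e /= e0 eP]|[e e0 eP]].
  have eE : e = (complex.Re e)%:C by rewrite RRe_real// gtr0_real.
  move: e0 eP; rewrite eE ltcR => e0 eP; exists (complex.Re e) => // w wz.
  by apply: eP; rewrite /ball/= -ltcR in wz *; rewrite distrC.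
exists e%:C; rewrite /= ?ltcR// => w; rewrite /ball/= => wz.
by apply: eP; rewrite -ltcR; rewrite distrC in wz.
Qed.

Lemma cvgC (T : Type) (F : set_system T) (FF : Filter F) (g : T -> R[i]^o) (l : R[i]^o) :
  g @ F --> l <-> forall e : R, 0 < e -> \forall x \near F, normc (g x - l) < e.
Proof.
rewrite cvgrPdist_lt; split => [h e e0|h e e0].
  have := h e%:C; rewrite ltcR => /(_ e0); apply: filterS => x.
  by rewrite distrC -ltcR.
have eE : e = (complex.Re e)%:C by rewrite RRe_real// gtr0_real.
move: e0; rewrite eE ltcR => /h; apply: filterS => x.
by rewrite distrC -ltcR.
Qed.

End ComplexNorm.

(** * Derivatives as first-order expansions *)

(** Multiplying the difference quotient out by [w - z] turns the punctured limit into an estimate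
    that is trivial at [w = z], so full neighbourhoods can be used. *)
Lemma is_deriveP (K : numFieldType) (h : K^o -> K^o) (z d : K^o) :
  is_derive z 1 h d <-> forall e : K, 0 < e ->
    \forall w \near z, `|h w - h z - d * (w - z)| <= e * `|w - z|.
Proof.
have key : (w^-1 *: ((h \o shift z) (w *: 1) - h z) @[w --> (0:K^o)^'] --> d) <->
    forall e : K, 0 < e ->
    \forall w \near z, `|h w - h z - d * (w - z)| <= e * `|w - z|.
  have eqv (w : K) e : w != z ->
      (`|d - (w - z)^-1 * (h w - h z)| <= e) =
      (`|h w - h z - d * (w - z)| <= e * `|w - z|).
    rewrite -subr_eq0 => wz.
    by rewrite -ler_pdivrMr ?normr_gt0// -normf_div mulrBl mulfK// distrC mulrC.
  rewrite cvgrPdist_le; split => H e e0; have {}H := H e e0.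
    rewrite (near_shift (0:K^o)) /=; move: H.
    rewrite /dnbhs near_withinE; apply: filterS => w /= wH.
    rewrite subr0.
    have [->|w0] := eqVneq w 0.
      by rewrite add0r !subrr mulr0 subr0 normr0 mulr0.
    have wz : w + z != z by rewrite -subr_eq0 addrK.
    have := wH w0; rewrite {1}/GRing.scale /= {1}/GRing.scale /= mulr1 => {}wH.
    by have := eqv (w + z) e wz; rewrite addrK => <-.
  move: H; rewrite (near_shift (0:K^o)) /dnbhs near_withinE /=.
  apply: filterS => w; rewrite subr0 /= addrK => wH w0.
  rewrite {1}/GRing.scale/= {1}/GRing.scale/= mulr1.
  have wz : w + z != z by rewrite -subr_eq0 addrK.
  by have := eqv (w + z) e wz; rewrite addrK => ->.
split=> [hd|H].
  apply/key; have dz := @ex_derive _ _ _ _ _ _ _ hd.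
  by rewrite -(@derive_val _ _ _ _ _ _ _ hd); exact: dz.
have {}H := key.2 H; apply: DeriveDef; first by apply/cvg_ex; exists d.
exact: cvg_lim H.
Qed.

Lemma is_derive_subr (K : numFieldType) (b z : K^o) :
  is_derive z 1 (fun w : K^o => w - b : K^o) 1.
Proof.
apply/is_deriveP => e e0; near=> w.
by rewrite mul1r opprB addrA subrK subrr normr0 mulr_ge0// ltW.
Unshelve. all: by end_near. Qed.

(** * Real derivatives of complex functions along lines *)

Section DirectionalDerivative.
Variable R : realType.
Local Notation normc := (@Normc.normc R).
Local Notation C := (R[i]^o).

Lemma is_deriveC (h : C -> C) (z d : C) :
  is_derive z 1 h d <-> forall e : R, 0 < e ->
    exists2 r : R, 0 < r & forall w, normc (w - z) < r ->
      normc (h w - h z - d * (w - z)) <= e * normc (w - z).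
Proof.
rewrite is_deriveP; split => H e e0.
  have := H e%:C; rewrite ltcR => /(_ e0) /nbhsC[r r0 rP]; exists r => // w /rP.
  by rewrite -lecR rmorphM.
have eE : e = (complex.Re e)%:C by rewrite RRe_real// gtr0_real.
move: e0; rewrite eE ltcR => /H[r r0 rP]; apply/nbhsC; exists r => // w /rP.
by rewrite -lecR rmorphM.
Qed.

(** Reduces complex differentiation to real calculus. The factor [u] selects a real component: [1]
    gives the real part, [- 'i] the imaginary part, and a conjugate the component in a given
    direction. *)
Lemma is_derive_line (h : C -> C) (u z eta d : C) (t : R) :
  is_derive (z + t%:C * eta) 1 h d ->
  is_derive (t : R^o) 1 (fun t : R^o => complex.Re (u * h (z + t%:C * eta)) : R^o)
    (complex.Re (u * (d * eta))).
Proof.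
move=> /is_deriveC H; apply/is_deriveP => e e0.
(* The added [1] keeps the divisors positive when [u] or [eta] vanishes. *)
pose M := normc u * normc eta + 1.
have M0 : 0 < M by rewrite ltr_wpDl// mulr_ge0// normc_ge0.
have [r r0 rP] := H _ (divr_gt0 e0 M0).
have E0 : 0 < normc eta + 1 by rewrite ltr_wpDl// normc_ge0.
near=> s.
have sr : normc (z + s%:C * eta - (z + t%:C * eta)) = `|s - t| * normc eta.
  by rewrite opprD addrACA subrr add0r -mulrBl -rmorphB Normc.normcM normc_real.
have {}rP : normc (h (z + s%:C * eta) - h (z + t%:C * eta) - d * ((s - t)%:C * eta))
   <= e / M * (`|s - t| * normc eta).
  rewrite -sr.
  have -> : (s - t)%:C * eta = z + s%:C * eta - (z + t%:C * eta).
    by rewrite opprD addrACA subrr add0r rmorphB mulrBl.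
  apply: rP; rewrite sr.
  have : `|t - s| < r / (normc eta + 1).
    by near: s; apply: (@cvgr_dist_lt _ R^o); [exact: cvg_id|exact: divr_gt0].
  rewrite distrC ltr_pdivlMr//; apply: le_lt_trans.
  by rewrite ler_wpM2l// lerDl.
have -> : complex.Re (u * h (z + s%:C * eta)) - complex.Re (u * h (z + t%:C * eta)) -
    complex.Re (u * (d * eta)) * (s - t) =
    complex.Re (u * (h (z + s%:C * eta) - h (z + t%:C * eta) - d * ((s - t)%:C * eta))).
  have -> : complex.Re (u * (d * eta)) * (s - t) =
     complex.Re (u * (d * ((s - t)%:C * eta))).
    rewrite mulrC -ReZ; congr complex.Re.
    by rewrite -[in RHS](mulrCA (s - t)%:C) -[in RHS](mulrCA (s - t)%:C).
  by rewrite !mulrBr !ReB.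
apply: (le_trans (Re_le_normc _)); rewrite Normc.normcM.
apply: (le_trans (ler_wpM2l (normc_ge0 _) rP)).
have -> : normc u * (e / M * (`|s - t| * normc eta)) =
  e * `|s - t| * ((normc u * normc eta) / M) by field; rewrite gt_eqF.
rewrite ler_piMr// ?mulr_ge0// 1?ltW//.
by rewrite ltr_pdivrMr// mul1r ltrDl.
Unshelve. all: by end_near. Qed.

End DirectionalDerivative.

(** * Compactness, limits from inside the disk, continuous extensions, and a mean value
    inequality *)

Section DiskLimits.
Variable R : realType.
Local Notation normc := (@Normc.normc R).
Local Notation C := (R[i]^o).
Local Notation Re := complex.Re.

Lemma continuous_Complex :
  continuous (fun xy : R^o * R^o => (xy.1 +i* xy.2) : C).
Proof.
move=> [x y]; apply/cvgC => e e0.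
have e20 : 0 < e / 2 by rewrite divr_gt0.
near=> w.
apply: (le_lt_trans (normc_le_ReIm _)); rewrite [e]splitr; apply: ltrD.
  rewrite ReB/= distrC; near: w.
  by apply: (@cvgr_dist_lt _ R^o _ _ _ (fst : R^o * R^o -> R^o)) => //; exact: cvg_fst.
rewrite ImB/= distrC; near: w.
by apply: (@cvgr_dist_lt _ R^o _ _ _ (snd : R^o * R^o -> R^o)) => //; exact: cvg_snd.
Unshelve. all: by end_near. Qed.

Lemma continuous_normc : continuous (normc : C -> R^o).
Proof.
move=> z; apply: (@cvgrPdist_lt R R^o C (nbhs (z : C)) _ normc (normc z)).2 => e e0.
apply/nbhsC; exists e => // w wz.
by rewrite distrC; apply: le_lt_trans (normc_dist _ _) wz.
Qed.

Lemma closed_normc_preimage (D : set R^o) :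
  closed D -> closed ((normc : C -> R^o) @^-1` D).
Proof.
by move=> cD; apply: (@preimage_closed C R^o) cD => z _; exact: continuous_normc.
Qed.

Lemma compact_normc_le (B : R) : compact [set z : C | normc z <= B].
Proof.
(* The ball is a closed subset of the image of this compact square under [(x, y) -> x + iy]. *)
have sq : compact (`[- B, B]%classic `*` `[- B, B]%classic : set (R^o * R^o)).
  by apply: compact_setX; exact: segment_compact.
have sqC := continuous_compact (continuous_subspaceT continuous_Complex) sq.
apply: subclosed_compact sqC _.
  rewrite (_ : mkset _ = normc @^-1` [set x : R^o | x <= B])//.
  by apply: closed_normc_preimage; exact: closed_le.
move=> [x y]/= xyB; exists (x, y) => //; split; rewrite /= in_itv/= -ler_norml.
  exact: le_trans (Re_le_normc (x +i* y)) xyB.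
exact: le_trans (Im_le_normc (x +i* y)) xyB.
Qed.

(** Completeness is drawn from compactness: the bound [B] confines the Cauchy filter to a compact
    ball. *)
Lemma cauchy_cvgC (T : Type) (F : set_system T) (FF : ProperFilter F) (h : T -> C)
    (B : R) :
  (\forall x \near F, normc (h x) <= B) ->
  (forall e : R, 0 < e -> exists l, \forall x \near F, normc (h x - l) < e) ->
  cvg (h @ F).
Proof.
move=> hB hF; apply: compact_cauchy_cvg hB (@compact_normc_le B).
apply/cauchy_exP => e e0.
have eE : e = (Re e)%:C by rewrite RRe_real// gtr0_real.
move: e0; rewrite eE ltcR => /hF[l hl]; exists l.
by apply: filterS hl => x; rewrite -ltcR /ball/= distrC.
Qed.

Lemma closed_disk_compact : compact (@closed_disk R : set C).
Proof.
have -> : (@closed_disk R : set C) = [set z : C | normc z <= 1].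
  by apply/seteqP; split => z /=; rewrite normc_le1.
exact: compact_normc_le.
Qed.

Lemma unit_circle_compact : compact (@unit_circle R : set C).
Proof.
apply: subclosed_compact (closed_disk_compact) _.
  have -> : (@unit_circle R : set C) = normc @^-1` [set x : R^o | x = 1].
    by apply/seteqP; split => z /normc_eq1.
  by apply: closed_normc_preimage; exact: closed_eq.
by move=> z /normc_eq1 z1; rewrite normc_le1 z1.
Qed.

Lemma unit_circle1 : unit_circle (1 : R[i]).
Proof. by apply/normc_eq1; rewrite Normc.normc1. Qed.

(** Approach to [z] through the open disk only, so that boundary values of functions known inside
    the disk are limits along this filter. *)
Definition at_disk (z : C) : set_system C := within (@open_disk R) (nbhs z).

Global Instance at_disk_filter z : Filter (at_disk z).
Proof. exact: within_filter. Qed.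

Lemma at_diskP (z : C) (P : C -> Prop) : (\forall w \near at_disk z, P w) <->
  exists2 e : R, 0 < e & forall w, normc w < 1 -> normc (w - z) < e -> P w.
Proof.
rewrite /at_disk near_withinE; split => [/nbhsC|] [e e0 eP].
  by exists e => // w w1 wz; apply: eP => //; rewrite normc_lt1.
by apply/nbhsC; exists e => // w wz; rewrite normc_lt1 => w1; exact: eP.
Qed.

Lemma near_disk_norm (z : C) : \forall w \near at_disk z, normc w < 1.
Proof. by apply/at_diskP; exists 1. Qed.

Lemma near_disk_dist (z : C) (e : R) : 0 < e ->
  \forall w \near at_disk z, normc (w - z) < e.
Proof. by move=> e0; apply/at_diskP; exists e. Qed.

(** The radial points [(1 - d) z] lie in the open disk and tend to [z]. *)
Lemma at_disk_proper (z : C) : normc z <= 1 -> ProperFilter (at_disk z).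
Proof.
move=> z1; split; last exact: at_disk_filter.
move=> /at_diskP[e e0 /=].
pose d := Num.min (2^-1) (e / 2).
have d0 : 0 < d by rewrite lt_min invr_gt0 ltr0n divr_gt0.
have d1 : d <= 2^-1 by rewrite ge_min lexx.
have d2 : d <= e / 2 by rewrite ge_min lexx orbT.
move=> /(_ ((1 - d)%:C * z)); apply.
  rewrite Normc.normcM normc_real ger0_norm; last by lra.
  rewrite (@le_lt_trans _ _ (1 - d))//; last by lra.
  by rewrite ler_piMr//; lra.
have -> : (1 - d)%:C * z - z = (- d)%:C * z by rewrite rmorphB rmorphN rmorph1; ring.
rewrite Normc.normcM normc_real normrN gtr0_norm//.
rewrite (@le_lt_trans _ _ d)//; last by lra.
by rewrite ler_piMr// ltW.
Qed.

Lemma cvg_at_disk (h : C -> C) (z : C) : {for z, continuous h} -> h @ at_disk z --> h z.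
Proof.
move=> hz; apply: cvg_trans hz => P; rewrite /at_disk /within/= => hP.
by apply: (@filterS _ (nbhs (z : C)) _ (h @^-1` P)) hP => w hw _.
Qed.

Lemma at_disk_lim_unique (h : C -> C) (z l1 l2 : C) : normc z <= 1 ->
  h @ at_disk z --> l1 -> h @ at_disk z --> l2 -> l1 = l2.
Proof.
move=> z1 h1 h2; have FF := at_disk_proper z1.
exact: (@cvg_unique C (@norm_hausdorff _ C) (h @ at_disk z) _ _ _ h1 h2).
Qed.

Lemma at_disk_cvg_eq (h g : C -> C) (z l : C) : (forall w, normc w < 1 -> h w = g w) ->
  h @ at_disk z --> l -> g @ at_disk z --> l.
Proof.
move=> hg; apply: cvg_trans; apply: near_eq_cvg.
by near=> w; rewrite hg//; near: w; exact: near_disk_norm.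
Unshelve. all: by end_near. Qed.

Lemma at_disk_cvg_normc_le (h : C -> C) (z l : C) (B : R) : normc z <= 1 ->
  (forall w, normc w < 1 -> normc (h w) <= B) ->
  h @ at_disk z --> l -> normc l <= B.
Proof.
move=> z1 hB hl; have FF := at_disk_proper z1.
apply/ler_addgt0Pr => e e0.
have /cvgC/(_ _ e0) H := hl.
near (at_disk z) => w.
have w1 : normc w < 1 by near: w; exact: near_disk_norm.
have wl : normc (h w - l) < e by near: w.
rewrite -(subrK (h w) l) addrC (le_trans (normcD_le _ _))//.
by apply: lerD; [exact: hB|rewrite normcBC ltW].
Unshelve. all: by end_near. Qed.

(** Pointwise interior limits already give continuity on the closed disk: if [f] is within [e / 2]
    of [F z] on the part of the disk near [z], then every nearby [F w], being a limit of such values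
    of [f], is within [e / 2] as well. *)
Lemma continuous_extension_lim (f F : R[i] -> R[i]) :
  (forall z, normc z < 1 -> F z = f z) ->
  (forall z, normc z <= 1 -> f @ at_disk z --> (F z : C)) ->
  continuous_extension f F.
Proof.
move=> Ff limF; split; first by move=> z; rewrite normc_lt1; exact: Ff.
apply/subspace_continuousP => z; rewrite normc_le1 => z1.
apply/cvgC => e e0.
have e20 : 0 < e / 2 by rewrite divr_gt0.
have /cvgC/(_ _ e20)/at_diskP[r r0 rP] := limF z z1.
rewrite /= near_withinE; apply/nbhsC; exists r => // w wz; rewrite normc_le1 => w1.
apply: (@le_lt_trans _ _ (e / 2)); last by rewrite ltr_pdivrMr// ltr_pMr// ltr1n.
have FF := at_disk_proper w1.
apply/ler_addgt0Pr => d d0.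
have /cvgC/(_ _ d0) H := limF w w1.
have rw : 0 < r - normc (w - z) by rewrite subr_gt0.
near (at_disk w) => v.
have v1 : normc v < 1 by near: v; exact: near_disk_norm.
have vF : normc (f v - F w) < d by near: v.
have vw : normc (v - w) < r - normc (w - z) by near: v; exact: near_disk_dist.
have -> : F w - F z = (F w - f v) + (f v - F z) by rewrite addrA subrK.
rewrite (le_trans (normcD_le _ _))// addrC lerD//; last by rewrite normcBC ltW.
rewrite ltW//; apply: rP => //.
have -> : v - z = (v - w) + (w - z) by rewrite addrA subrK.
by rewrite (le_lt_trans (normcD_le _ _))// -ltrBrDr.
Unshelve. all: by end_near. Qed.

Lemma continuous_extension_cvg (f F : R[i] -> R[i]) (z : R[i]) :
  continuous_extension f F -> normc z <= 1 -> f @ at_disk z --> (F z : C).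
Proof.
move=> [Ff /subspace_continuousP cF] z1.
have /cF/cvgC H : closed_disk z by rewrite normc_le1.
apply/cvgC => e /H; rewrite near_withinE => /nbhsC[r r0 rP].
apply/at_diskP; exists r => // w w1 wz.
by rewrite -Ff ?normc_lt1//; apply: rP => //; rewrite normc_le1 ltW.
Qed.

(** Multiplying [h] by the conjugate [u] of the total increment makes that increment real, equal to
    its squared modulus. The real mean value theorem then applies to the real part of [u * h] on the
    segment. *)
Lemma normc_mean_value (h dh : C -> C) (w1 w2 : C) (B : R) :
  (forall t : R, 0 <= t <= 1 ->
    is_derive (w1 + t%:C * (w2 - w1)) 1 h (dh (w1 + t%:C * (w2 - w1)))) ->
  (forall t : R, 0 <= t <= 1 -> normc (dh (w1 + t%:C * (w2 - w1))) <= B) ->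
  normc (h w2 - h w1) <= B * normc (w2 - w1).
Proof.
move=> hd hB.
have [->|D0] := eqVneq (h w2) (h w1).
  rewrite subrr Normc.normc0 mulr_ge0 ?normc_ge0//.
  by apply: le_trans (hB 0 _); rewrite ?normc_ge0// lexx ler01.
rewrite -subr_eq0 -normc_gt0 in D0.
pose u := (h w2 - h w1)^*.
have uE : normc u = normc (h w2 - h w1) by exact: normc_conj.
pose phi (t : R^o) : R^o := Re (u * h (w1 + t%:C * (w2 - w1))).
have dphi (t : R) : 0 <= t <= 1 -> is_derive (t : R^o) 1 phi
    (Re (u * (dh (w1 + t%:C * (w2 - w1)) * (w2 - w1)))).
  by move=> /hd; exact: is_derive_line.
have [||t + ] := @MVT_segment R phi
  (fun t => Re (u * (dh (w1 + t%:C * (w2 - w1)) * (w2 - w1)))) 0 1 ler01.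
- by move=> t; rewrite in_itv/= => /andP[t0 t1]; apply: dphi; rewrite !ltW.
- apply: derivable_within_continuous => t; rewrite in_itv/= => /dphi td.
  exact: (@ex_derive _ _ _ _ _ _ _ td).
rewrite in_itv/= => t01; rewrite subr0 mulr1 /phi rmorph1 mul1r rmorph0 mul0r addr0.
rewrite [w1 + _]addrC subrK -ReB -mulrBr mulrC conj_normc/= => E.
have : normc (h w2 - h w1) ^+ 2 <= normc (h w2 - h w1) * (B * normc (w2 - w1)).
  rewrite E (le_trans (ler_norm _))// (le_trans (Re_le_normc _))//.
  rewrite Normc.normcM uE Normc.normcM ler_wpM2l ?normc_ge0//.
  by rewrite ler_wpM2r ?normc_ge0// hB.
by rewrite expr2 ler_pM2l.
Qed.

End DiskLimits.

(** * Arithmetic of limits from inside the disk *)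

Section DiskLimitOperations.
Variables (R : realType) (z : R[i]^o).
Local Notation C := (R[i]^o).
Implicit Types g h : C -> C.

Lemma at_disk_cvgD g h (l m : C) : g @ at_disk z --> l -> h @ at_disk z --> m ->
  (fun w => g w + h w) @ at_disk z --> (l + m : C).
Proof. exact: (@cvgD _ C). Qed.

Lemma at_disk_cvgB g h (l m : C) : g @ at_disk z --> l -> h @ at_disk z --> m ->
  (fun w => g w - h w) @ at_disk z --> (l - m : C).
Proof. exact: (@cvgB _ C). Qed.

Lemma at_disk_cvgM g h (l m : C) : g @ at_disk z --> l -> h @ at_disk z --> m ->
  (fun w => g w * h w) @ at_disk z --> (l * m : C).
Proof. exact: cvgM. Qed.

Lemma at_disk_cvg_cst (x : C) : (fun=> x) @ at_disk z --> x.
Proof. exact: cvg_cst. Qed.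

Lemma at_disk_cvg_id : id @ at_disk z --> z.
Proof. exact: cvg_within. Qed.

End DiskLimitOperations.

Arguments at_disk_cvg_cst {R} z x.
Arguments at_disk_cvg_id {R} z.

(** * The maximum modulus principle through second derivatives *)

Section MaximumModulus.
Variable R : realType.
Local Notation normc := (@Normc.normc R).
Local Notation C := (R[i]^o).
Local Notation Re := complex.Re.
Local Notation Im := complex.Im.

(** The real part of [conj g * h] is the Euclidean scalar product of [g] and [h], so this is its
    product rule; [g = h] gives the derivative of the squared modulus. *)
Lemma is_derive_dot (g h : C -> C) (z eta dg dh : C) (t : R) :
  is_derive (z + t%:C * eta) 1 g dg -> is_derive (z + t%:C * eta) 1 h dh ->
  is_derive (t : R^o) 1
    (fun t : R^o => Re ((g (z + t%:C * eta))^* * h (z + t%:C * eta)) : R^o)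
    (Re ((dg * eta)^* * h (z + t%:C * eta) + (g (z + t%:C * eta))^* * (dh * eta))).
Proof.
move=> hg hh.
have ReE (x : C) : Re x = Re (1 * x) by rewrite mul1r.
have ImE (x : C) : Im x = Re (- 'i * x) by case: x => a b /=; ring.
have -> : (fun t : R^o => Re ((g (z + t%:C * eta))^* * h (z + t%:C * eta)) : R^o) =
  (fun t : R^o => Re (1 * g (z + t%:C * eta))) *
  (fun t : R^o => Re (1 * h (z + t%:C * eta))) +
  (fun t : R^o => Re (- 'i * g (z + t%:C * eta))) *
  (fun t : R^o => Re (- 'i * h (z + t%:C * eta))).
  apply/funext => x; rewrite /= !fctE -!ReE -!ImE.
  by case: (g _) => a b; case: (h _) => a' b' /=; ring.
have h1 := is_derive_line 1 hg; have h2 := is_derive_line 1 hh.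
have h3 := is_derive_line (- 'i) hg; have h4 := is_derive_line (- 'i) hh.
apply: is_derive_eq; rewrite -!ReE -!ImE /GRing.scale/=.
case: (g _) => a b; case: (h _) => a' b'.
case: (dg * eta) => x y; case: (dh * eta) => x' y' /=.
by ring.
Qed.

(** At the maximum [psi 0 = 0]. If [c] were positive, [psi] would be positive just to the right of
    [0], and the mean value theorem would make [phi] exceed [phi 0] there. *)
Lemma second_derivative_at_max (phi psi : R^o -> R^o) (c r : R) : 0 < r ->
  (forall t : R, `|t| < r -> is_derive (t : R^o) 1 phi (psi t)) ->
  is_derive (0 : R^o) 1 psi c ->
  (forall t : R, `|t| < r -> phi t <= phi 0) -> c <= 0.
Proof.
move=> r0 dphi dpsi mx; rewrite leNgt; apply/negP => c0.
have psi0 : psi 0 = 0.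
  have d0 : is_derive (0 : R^o) 1 phi (psi 0) by apply: dphi; rewrite normr0.
  have m0 := @derive1_at_max R phi (- r) r 0.
  have lr : - r <= r by lra.
  have dd : forall t, t \in `]- r, r[ -> derivable phi t 1.
    move=> t; rewrite in_itv/= -ltr_norml => tr.
    have ht := dphi t tr; exact: (@ex_derive _ _ _ _ _ _ _ ht).
  have in0 : 0 \in `]- r, r[ by rewrite in_itv/= oppr_lt0 r0.
  have mm : forall t, t \in `]- r, r[ -> phi t <= phi 0.
    by move=> t; rewrite in_itv/= -ltr_norml => /mx.
  have h0 := m0 lr dd in0 mm.
  by rewrite -(@derive_val _ _ _ _ _ _ _ d0) (@derive_val _ _ _ _ _ _ _ h0).
have c20 : 0 < c / 2 by lra.
have /is_deriveP/(_ _ c20)/nbhs_ballP[d /= d0 dP] := dpsi.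
pose s := Num.min d r / 2.
have m0 : 0 < Num.min d r by rewrite lt_min d0.
have s0 : 0 < s by rewrite divr_gt0.
have sd : s < d.
  by rewrite (@lt_le_trans _ _ (Num.min d r))// ?ge_min ?lexx// /s; lra.
have sr : s < r.
  by rewrite (@lt_le_trans _ _ (Num.min d r))// ?ge_min ?lexx ?orbT// /s; lra.
have [||x + E] := @MVT R phi psi 0 s s0.
- move=> t; rewrite in_itv/= => /andP[t0 ts]; apply: dphi.
  by rewrite gtr0_norm// (lt_trans ts).
- apply: derivable_within_continuous => t; rewrite in_itv/= => /andP[t0 ts].
  have ht : is_derive (t : R^o) 1 phi (psi t).
    by apply: dphi; rewrite ger0_norm// (le_lt_trans ts).
  exact: (@ex_derive _ _ _ _ _ _ _ ht).
rewrite in_itv/= => /andP[x0 xs].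
have := dP x; rewrite /ball/= sub0r normrN gtr0_norm// (lt_trans xs)// psi0 !subr0.
move=> /(_ isT). rewrite (gtr0_norm x0) ler_norml => /andP[h1 _].
have px : 0 < psi x by have := mulr_gt0 c0 x0; lra.
have : phi s <= phi 0 by apply: mx; rewrite gtr0_norm.
by rewrite -subr_le0 E subr0 leNgt mulr_gt0.
Qed.

(* The perturbation makes the Laplacian of [|k|^2 + e |z|^2] positive, so that
   this function has no local maximum in the open disk. *)
Lemma perturbed_no_interior_max (k dk ddk : C -> C) (e : R) (z1 : C) : 0 < e ->
  (forall z : C, normc z < 1 -> is_derive z 1 k (dk z)) ->
  (forall z : C, normc z < 1 -> is_derive z 1 dk (ddk z)) ->
  normc z1 < 1 ->
  ~ (forall z, normc z < 1 ->
      normc (k z) ^+ 2 + e * normc z ^+ 2 <= normc (k z1) ^+ 2 + e * normc z1 ^+ 2).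
Proof.
move=> e0 hk hdk z11 mx.
have dotE (x : C) : Re (x^* * x) = normc x ^+ 2.
  by rewrite mulrC conj_normc.
have key (eta : C) : normc eta = 1 ->
  2 * Re ((dk z1 * eta)^* * (dk z1 * eta) + (k z1)^* * (ddk z1 * eta * eta)) + 2 * e <= 0.
  move=> eta1; pose r := 1 - normc z1.
  have r0 : 0 < r by rewrite subr_gt0.
  have inD (t : R) : `|t| < r -> normc (z1 + t%:C * eta) < 1.
    move=> tr; apply: (le_lt_trans (normcD_le _ _)).
    by rewrite Normc.normcM normc_real eta1 mulr1 addrC -ltrBrDr.
  pose phi (t : R^o) : R^o := Re ((k (z1 + t%:C * eta))^* * k (z1 + t%:C * eta)) +
     e * Re ((z1 + t%:C * eta)^* * (z1 + t%:C * eta)).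
  pose psi (t : R^o) : R^o :=
     2 * Re ((k (z1 + t%:C * eta))^* * (dk (z1 + t%:C * eta) * eta)) +
     2 * e * Re ((z1 + t%:C * eta)^* * eta).
  apply: (@second_derivative_at_max phi psi _ r r0).
  - move=> t /inD tD.
    have h1 := is_derive_dot (hk _ tD) (hk _ tD).
    have hid := is_derive_id (z1 + t%:C * eta) (1 : C).
    have h2 := is_derive_dot hid hid.
    have h3 := is_deriveD h1 (is_deriveZ e h2).
    apply: is_derive_eq h3 _; rewrite /psi /GRing.scale/= mul1r.
    case: (k _) => a b; case: (dk _ * _) => c d.
    case: (z1 + _) => x y; case: (eta) => u v /=; ring.
  - have z0E : z1 + 0%:C * eta = z1 by rewrite rmorph0 mul0r addr0.
    have zD : normc (z1 + 0%:C * eta) < 1 by apply: inD; rewrite normr0.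
    have heta := is_derive_cst eta (z1 + 0%:C * eta) (1 : C).
    have hdke : is_derive (z1 + 0%:C * eta) 1 (fun w => dk w * eta)
        (ddk (z1 + 0%:C * eta) * eta).
      have h := is_deriveM (hdk _ zD) heta.
      by apply: is_derive_eq h _; rewrite /GRing.scale/= mulr0 add0r mulrC.
    have h1 := is_derive_dot (hk _ zD) hdke.
    have h2 := is_derive_dot (is_derive_id (z1 + 0%:C * eta) (1 : C)) heta.
    have h3 := is_deriveD (is_deriveZ 2 h1) (is_deriveZ (2 * e) h2).
    apply: is_derive_eq h3 _; rewrite z0E /GRing.scale/= mul1r mul0r mulr0 addr0.
    by rewrite (dotE eta) eta1 expr1n mulr1.
  - by move=> t /inD /mx; rewrite /phi !dotE rmorph0 mul0r addr0.
(* Adding the directions [1] and ['i] cancels the terms with [ddk], because ['i ^+ 2 = -1]; what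
   remains is [4 |dk z1|^2 + 4 e <= 0], which is absurd. *)
have := key 1; have := key 'i.
rewrite Normc.normc1 /= expr0n/= add0r expr1n sqrtr1 => /(_ erefl) h1 /(_ erefl) h2.
have h3 : 0 <= normc (dk z1) ^+ 2 by rewrite exprn_ge0// normc_ge0.
move: h1 h2 h3; rewrite sqr_normcE !mulr1.
case: (k z1) => a b; case: (dk z1) => c d; case: (ddk z1) => x y /=.
nra.
Qed.

(** Take [z0] maximising [|K|] on the circle. For each [e > 0] the maximum of [|K|^2 + e |z|^2] over
    the closed disk is not attained inside, so it is at most [|K z0|^2 + e]; then [e] tends to
    [0]. *)
Lemma maximum_modulus (k dk ddk K : R[i] -> R[i]) :
  (forall z : C, normc z < 1 -> is_derive z 1 (k : C -> C) (dk z)) ->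
  (forall z : C, normc z < 1 -> is_derive z 1 (dk : C -> C) (ddk z)) ->
  continuous_extension k K ->
  exists2 z0, unit_circle z0 & forall z, normc z <= 1 -> normc (K z) <= normc (K z0).
Proof.
move=> hk hdk [Kk cK].
have cN2 (H : C -> C) (z : C) (A : set C) :
    H @ within A (nbhs z) --> H z ->
    (fun w => normc (H w) ^+ 2 : R^o) @ within A (nbhs z) --> (normc (H z) ^+ 2 : R^o).
  move=> hH; rewrite expr2.
  under eq_fun do rewrite expr2.
  have hn : (fun w => normc (H w) : R^o) @ within A (nbhs z) --> (normc (H z) : R^o).
    exact: (@cvg_comp C C R^o H normc _ _ _ hH (@continuous_normc R (H z))).
  exact: (@cvgM R _ _ _ _ _ _ _ hn hn).
have cN : {within (@closed_disk R : set C), continuous (fun z => normc (K z) ^+ 2 : R^o)}.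
  apply/subspace_continuousP => z zD; apply: cN2.
  by move/subspace_continuousP : cK; exact.
have cNe e : {within (@closed_disk R : set C),
    continuous (fun z => normc (K z) ^+ 2 + e * normc z ^+ 2 : R^o)}.
  apply/subspace_continuousP => z zD; apply: (@cvgD R R^o).
    by move/subspace_continuousP : cN; exact.
  apply: (@cvgM R); first exact: cvg_cst.
  by apply: (cN2 id); exact: cvg_within.
have sub : (@unit_circle R : set C) `<=` (@closed_disk R : set C).
  by move=> z /normc_eq1 z1; rewrite normc_le1 z1.
have T0 : (@unit_circle R : set C) !=set0 by exists 1; exact: unit_circle1.
have D0 : (@closed_disk R : set C) !=set0 by exists 1; apply: sub; exact: unit_circle1.
have [z0 z0T z0m] := compact_EVT_max T0
  (@unit_circle_compact R) (continuous_subspaceW sub cN).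
rewrite inE in z0T.
exists z0 => // z z1.
rewrite -(ler_pXn2r (_ : 0 < 2)%N) ?nnegrE ?normc_ge0//.
apply/ler_addgt0Pr => e e0.
have [w wD wm] := compact_EVT_max D0
  (@closed_disk_compact R) (cNe e).
rewrite inE normc_le1 in wD.
apply: (@le_trans _ _ (normc (K z) ^+ 2 + e * normc z ^+ 2)).
  by rewrite lerDl mulr_ge0 ?exprn_ge0 ?normc_ge0// ltW.
apply: (le_trans (wm z _)); first by rewrite inE normc_le1.
move: wD; rewrite le_eqVlt => /orP[/eqP w1|w1].
  rewrite w1 expr1n mulr1 lerD2r; apply: z0m.
  by rewrite inE; apply/normc_eq1.
have := perturbed_no_interior_max e0 hk hdk w1; case => v v1.
have := wm v; rewrite inE normc_le1 ltW// => /(_ isT).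
by rewrite !Kk ?normc_lt1.
Qed.

End MaximumModulus.

(** * First-order conditions at a boundary maximum of the modulus *)

Section BoundaryMaximum.
Variable R : realType.
Local Notation normc := (@Normc.normc R).
Local Notation C := (R[i]^o).
Local Notation Re := complex.Re.
Local Notation Im := complex.Im.

Lemma cvg_conjc (T : Type) (F : set_system T) (FF : Filter F) (g : T -> C) (l : C) :
  g @ F --> l -> (fun x => (g x)^* : C) @ F --> (l^* : C).
Proof.
move=> /cvgC H; apply/cvgC => e /H; apply: filterS => x.
by rewrite -rmorphB normc_conj.
Qed.

Lemma cvg_Re_gt0 (T : Type) (F : set_system T) (FF : Filter F) (g : T -> C) (l : C) :
  g @ F --> l -> 0 < Re l -> \forall x \near F, 0 < Re (g x).
Proof.
move=> /cvgC H l0; have := H _ l0; apply: filterS => x xl.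
have := le_lt_trans (Re_le_normc _) xl.
by rewrite ReB ltr_norml => /andP[]; lra.
Qed.

(** For [Re eta < 0] the direction [z0 * eta] points into the disk. The real part in the conclusion
    is the limit of half the derivative of [|k|^2] in that direction; if it were positive, [|k|]
    would increase strictly on the way in from [z0] and exceed [|l|]. *)
Lemma boundary_max_inward (k dk : C -> C) (z0 l dl eta : C) :
  (forall z : C, normc z < 1 -> is_derive z 1 k (dk z)) ->
  normc z0 = 1 -> k @ at_disk z0 --> l -> dk @ at_disk z0 --> dl ->
  (forall z, normc z < 1 -> normc (k z) <= normc l) ->
  Re eta < 0 -> Re (l^* * dl * z0 * eta) <= 0.
Proof.
move=> hk z01 hl hdl mx eta0; rewrite leNgt; apply/negP => W0.
have z01' : normc z0 <= 1 by rewrite z01.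
pose rho w := (k w)^* * dk w * z0 * eta.
have hrho : rho @ at_disk z0 --> (l^* * dl * z0 * eta : C).
  apply: cvgM; last exact: cvg_cst.
  apply: cvgM; last exact: cvg_cst.
  exact: (cvgM (cvg_conjc (at_disk_filter z0) hl) hdl).
have /at_diskP[r r0 rP] := cvg_Re_gt0 (at_disk_filter z0) hrho W0.
have En : 0 < normc eta.
  by rewrite normc_gt0; apply/eqP => e0; move: eta0; rewrite e0 ltxx.
pose w (t : R) := z0 + t%:C * (z0 * eta).
(* The first bound keeps [w t] within [r] of [z0]; the second is the length at which [|1 + t eta|]
   returns to [1], so [w t] stays in the open disk. *)
pose T := Num.min (r / normc eta) (- 2 * Re eta / normc eta ^+ 2).
have T0 : 0 < T.
  rewrite lt_min divr_gt0//= divr_gt0 ?exprn_gt0//; lra.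
have wr t : 0 < t < T -> normc (w t - z0) < r.
  move=> /andP[t0]; rewrite lt_min => /andP[tr _].
  rewrite /w addrC addKr Normc.normcM normc_real gtr0_norm// Normc.normcM z01 mul1r.
  by rewrite -ltr_pdivlMr.
have wD t : 0 < t < T -> normc (w t) < 1.
  move=> /andP[t0]; rewrite lt_min => /andP[_ tr].
  have -> : w t = z0 * (1 + t%:C * eta) by rewrite /w; ring.
  rewrite Normc.normcM z01 mul1r -(ltr_pXn2r (_ : 0 < 2)%N) ?nnegrE ?normc_ge0//.
  rewrite expr1n sqr_normcE ReD ImD ReZ ImZ/=.
  move: tr; rewrite ltr_pdivlMr ?exprn_gt0// sqr_normcE => tr.
  have := mulr_gt0 t0 t0.
  have : t * (t * (Re eta ^+ 2 + Im eta ^+ 2)) < t * (- 2 * Re eta).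
    by rewrite ltr_pM2l.
  by move=> *; lra.
pose phi (t : R^o) : R^o := Re ((k (w t))^* * k (w t)).
have phiE t : phi t = normc (k (w t)) ^+ 2 by rewrite /phi mulrC conj_normc.
have dphi t : 0 < t < T -> is_derive (t : R^o) 1 phi (2 * Re (rho (w t))).
  move=> tT; have h := is_derive_dot (hk _ (wD t tT)) (hk _ (wD t tT)).
  apply: is_derive_eq h _; rewrite /rho -/(w t).
  rewrite -!mulrA -[dk (w t) * (z0 * eta)]/(dk (w t) * (z0 * eta)).
  by case: (k _) => a b; case: (dk _ * _) => c d /=; ring.
have mono t1 t2 : 0 < t1 -> t1 < t2 -> t2 < T -> normc (k (w t1)) < normc (k (w t2)).
  move=> t10 t12 t2T.
  have [||x + E] := @MVT R phi (fun t => 2 * Re (rho (w t))) t1 t2 t12.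
  - move=> t; rewrite in_itv/= => /andP[h1 h2]; apply: dphi.
    by rewrite (lt_trans t10)//= (lt_trans h2).
  - apply: derivable_within_continuous => t; rewrite in_itv/= => /andP[h1 h2].
    have ht : 0 < t < T by rewrite (lt_le_trans t10)//= (le_lt_trans h2).
    have := dphi t ht => hh; exact: (@ex_derive _ _ _ _ _ _ _ hh).
  rewrite in_itv/= => /andP[h1 h2].
  have xT : 0 < x < T by rewrite (lt_trans t10)//= (lt_trans h2).
  rewrite -(ltr_pXn2r (_ : 0 < 2)%N) ?nnegrE ?normc_ge0// -!phiE -subr_gt0 E.
  by rewrite mulr_gt0 ?subr_gt0// mulr_gt0//; apply: rP; [exact: wD|exact: wr].
pose s := T / 2.
have sT : 0 < s < T by rewrite /s; apply/andP; split; lra.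
have s2T : 0 < s / 2 < s by move: sT => /andP[s0 _]; apply/andP; split; lra.
have [s0 s1] := andP sT; have [s20 s21] := andP s2T.
(* Since [k] is only known at [z0] through its limit, the contradiction is reached inside: for small
   [t], [|k (w t)|] lies below [|k (w (s / 2))|] by monotonicity, yet closer to [|l|] than this
   gap. *)
have gap : 0 < normc l - normc (k (w (s / 2))).
  rewrite subr_gt0; apply: (lt_le_trans (mono _ _ s20 s21 s1)).
  by apply: mx; exact: wD.
have /cvgC/(_ _ gap)/at_diskP[d d0 dP] := hl.
pose t := Num.min (s / 2 / 2) (d / normc eta / 2).
have t0 : 0 < t by rewrite lt_min !divr_gt0.
have ts : t < s / 2 by rewrite (@le_lt_trans _ _ (s / 2 / 2)) ?ge_min ?lexx//; lra.
have td : t * normc eta < d.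
  rewrite -ltr_pdivlMr// (@le_lt_trans _ _ (d / normc eta / 2)) ?ge_min ?lexx ?orbT//.
  have := divr_gt0 d0 En; lra.
have tT : 0 < t < T by rewrite t0/= (lt_trans ts)// (lt_trans s21).
have := dP (w t) (wD _ tT).
have -> : normc (w t - z0) = t * normc eta.
  by rewrite /w addrC addKr Normc.normcM normc_real gtr0_norm// Normc.normcM z01 mul1r.
move=> /(_ td) H.
have h1 := mono _ _ t0 ts (lt_trans s21 s1).
have := le_lt_trans (normc_dist _ _) H; rewrite ltr_norml => /andP[].
by move: h1; lra.
Qed.

(** A number whose product with every [eta] of the open left half-plane has nonpositive real part
    lies on the closed nonnegative real axis. For [l != 0] this number is [z0 * dl / l] up to the
    positive factor [|l|^2]. *)
Lemma boundary_max (k dk : C -> C) (z0 l dl : C) :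
  (forall z : C, normc z < 1 -> is_derive z 1 k (dk z)) ->
  normc z0 = 1 -> k @ at_disk z0 --> l -> dk @ at_disk z0 --> dl ->
  (forall z, normc z < 1 -> normc (k z) <= normc l) ->
  Im (l^* * dl * z0) = 0 /\ 0 <= Re (l^* * dl * z0).
Proof.
move=> hk z01 hl hdl mx.
have := boundary_max_inward hk z01 hl hdl mx.
case: (l^* * dl * z0) => x y H /=.
(* The directions [-d + 'i] and [-d - 'i] are nearly tangential to the circle; letting [d] tend to
   [0] forces [y = 0]. *)
have H1 d : 0 < d -> `|y| <= d * x.
  move=> d0; have := H ((- d) +i* 1); have := H ((- d) +i* (- 1)).
  rewrite /= oppr_lt0 d0 => /(_ isT) h1 /(_ isT) h2.
  by rewrite ler_norml; apply/andP; split; lra.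
have x0 : 0 <= x by rewrite -[x]mul1r; apply: le_trans (H1 1 ltr01).
split=> //; apply/eqP; rewrite -normr_le0.
apply/ler_addgt0Pr => e e0; rewrite add0r.
have x1 : 0 < x + 1 by lra.
apply: (le_trans (H1 (e / (x + 1)) _)); first exact: divr_gt0.
by rewrite mulrAC ler_pdivrMr// ler_pM2l//; lra.
Qed.

End BoundaryMaximum.

(** * Analytic functions with modulus [M * \prod_k |z - a_k|^{t_k}]: logarithmic derivative and
    extension to the closed disk *)

Section PrescribedModulus.
Variables (R : realType) (n : nat) (a : 'I_n -> R[i]) (t : 'I_n -> R).
Local Notation normc := (@Normc.normc R).
Local Notation C := (R[i]^o).
Local Notation Re := complex.Re.
Local Notation Im := complex.Im.
Hypothesis a1 : forall k, normc (a k) = 1.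
Variables (h : C -> C) (M : R).
Hypothesis hder : forall z : C, normc z < 1 -> derivable h z 1.
Hypothesis M0 : 0 <= M.
Hypothesis hmod : forall z : C, normc z < 1 ->
  normc (h z) = M * \prod_(k < n) normc (z - a k) `^ t k.

Definition logder (z : C) : C := \sum_(k < n) (t k)%:C / (z - a k).

Lemma disk_sub_neq0 (z : C) k : normc z < 1 -> z - a k != 0.
Proof.
by move=> z1; rewrite subr_eq0; apply/eqP => za; move: z1; rewrite za a1 ltxx.
Qed.

Lemma normc_disk_sub_gt0 (z : C) k : normc z < 1 -> 0 < normc (z - a k).
Proof. by move=> z1; rewrite normc_gt0 disk_sub_neq0. Qed.

Lemma ln_sqr_modulus (z : C) : 0 < M -> normc z < 1 ->
  ln (normc (h z) ^+ 2) = 2 * ln M + \sum_(k < n) t k * ln (normc (z - a k) ^+ 2).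
Proof.
move=> M1 z1.
have E : normc (h z) = M * expR (\sum_(k < n) t k * ln (normc (z - a k))).
  rewrite hmod// expR_sum; congr (_ * _); apply: eq_bigr => k _.
  by rewrite /powR gt_eqF// normc_disk_sub_gt0.
rewrite E lnXn ?mulr_gt0 ?expR_gt0// lnM ?posrE ?expR_gt0// expRK mulrnDl.
congr (_ + _); first by rewrite mulr_natl.
rewrite -sumrMnl; apply: eq_bigr => k _.
by rewrite lnXn ?normc_disk_sub_gt0// mulrnAr.
Qed.

(** The modulus alone determines [h' / h]: the derivative of [ln |h|^2] in the direction [eta] is
    twice the real part of [h' / h * eta], and differentiating the prescribed product gives the same
    expression with [logder]. *)
Lemma is_derive_logder (z : C) : normc z < 1 -> is_derive z 1 h (h z * logder z).
Proof.
move=> z1.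
have [M1|M_le0] := ltP 0 M; last first.
  have ME : M = 0 by apply/eqP; rewrite eq_le M_le0 M0.
  have h0 w : normc w < 1 -> h w = 0.
    by move=> w1; apply/eqP; rewrite -normc_eq0 hmod// ME mul0r.
  rewrite h0// mul0r; apply/is_deriveC => e e0; exists (1 - normc z).
    by rewrite subr_gt0.
  move=> w wz.
  have w1 : normc w < 1.
    by rewrite -(subrK z w) (le_lt_trans (normcD_le _ _))// -ltrBrDr.
  by rewrite !h0// mul0r !subr0 Normc.normc0 mulr_ge0 ?normc_ge0// ltW.
have hz0 : 0 < normc (h z).
  by rewrite hmod// mulr_gt0// prodr_gt0// => k _; rewrite powR_gt0// normc_disk_sub_gt0.
have hd : is_derive z 1 h ('D_1 h z) by apply: DeriveDef => //; exact: hder.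
move: ('D_1 h z) hd => d hd.
suff -> : h z * logder z = d by [].
have key (eta : C) : Re (d / h z * eta) = Re (logder z * eta).
  have z0E : z + 0%:C * eta = z by rewrite rmorph0 mul0r addr0.
  have dotE (x : C) : Re (x^* * x) = normc x ^+ 2 by rewrite mulrC conj_normc.
  have dlnN (g : C -> C) (dg : C) : is_derive z 1 g dg -> 0 < normc (g z) ->
    is_derive (0 : R^o) 1 (fun x : R^o => ln (normc (g (z + x%:C * eta)) ^+ 2) : R^o)
      (2 * Re (dg / g z * eta)).
    move=> gd gz.
    have gd0 : is_derive (z + 0%:C * eta) 1 g dg by rewrite z0E.
    have h1 := is_derive_dot gd0 gd0.
    have h2 : is_derive ((Re ((g (z + 0%:C * eta))^* * g (z + 0%:C * eta))) : R^o) 1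
        (@ln R : R^o -> R^o) (normc (g z) ^+ 2)^-1.
      by rewrite dotE z0E; apply: is_derive1_ln; rewrite exprn_gt0.
    have h3 := is_derive1_comp h2 h1.
    have -> : (fun x : R^o => ln (normc (g (z + x%:C * eta)) ^+ 2) : R^o) =
       @ln R \o (fun x : R^o => Re ((g (z + x%:C * eta))^* * g (z + x%:C * eta))).
      by apply/funext => x /=; rewrite dotE.
    apply: is_derive_eq h3 _; rewrite z0E.
    have gz2 : normc (g z) ^+ 2 != 0 by rewrite expf_neq0// gt_eqF.
    apply: (mulfI gz2); rewrite mulVKf//.
    rewrite [RHS]mulrCA -ReZ -conj_normc.
    have -> : g z * (g z)^* * (dg / g z * eta) = (g z)^* * (dg * eta).
      by field; rewrite -normc_gt0.
    by case: (g z) => x y; case: (dg * eta) => x' y' /=; ring.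
  have hL := dlnN _ _ hd hz0.
  have hk (k : 'I_n) : is_derive (0 : R^o) 1
     (fun x : R^o => t k * ln (normc (z + x%:C * eta - a k) ^+ 2) : R^o)
      (t k * (2 * Re (1 / (z - a k) * eta))).
    have hid := is_derive_subr (a k) z.
    exact: (is_deriveZ (t k) (dlnN _ _ hid (normc_disk_sub_gt0 k z1))).
  have hR := is_deriveD (is_derive_cst (2 * ln M) (0 : R^o) (1 : R^o)) (is_derive_sum hk).
  have hR' : is_derive (0 : R^o) 1
      (fun x : R^o => ln (normc (h (z + x%:C * eta)) ^+ 2) : R^o)
      (0 + \sum_(k < n) t k * (2 * Re (1 / (z - a k) * eta))).
    apply: near_eq_is_derive hR.
    have E0 : 0 < normc eta + 1 by rewrite ltr_wpDl// normc_ge0.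
    apply/nbhs_ballP; exists ((1 - normc z) / (normc eta + 1)).
      by rewrite /= divr_gt0// subr_gt0.
    move=> x; rewrite /ball/= sub0r normrN ltr_pdivlMr// => xr.
    rewrite ln_sqr_modulus// ?fctE ?fct_sumE//.
    rewrite (le_lt_trans (normcD_le _ _))// Normc.normcM normc_real addrC -ltrBrDr.
    by apply: le_lt_trans xr; rewrite ler_wpM2l// lerDl.
  have E : 2 * Re (d / h z * eta) = 0 + \sum_(k < n) t k * (2 * Re (1 / (z - a k) * eta)).
    by rewrite -(@derive_val _ _ _ _ _ _ _ hL) (@derive_val _ _ _ _ _ _ _ hR').
  have two0 : (2 : R) != 0 by rewrite pnatr_eq0.
  apply: (mulfI two0); rewrite E add0r /logder mulr_suml Re_sum mulr_sumr.
  by apply: eq_bigr => k _; rewrite mulrCA -ReZ mulrA mul1r.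
(* The directions [1] and ['i] give equality of the real and of the imaginary parts. *)
have e1 := key 1; have e2 := key 'i.
have hz : h z != 0 by rewrite -normc_gt0.
rewrite -[d](divfK hz) mulrC; congr (_ * _); apply/esym.
move: e1 e2; case: (d / h z) => x y; case: (logder z) => x' y' /=.
rewrite !mulr1 !mulr0 !subr0 !sub0r => -> /oppr_inj ->.
by [].
Qed.

Hypothesis t0 : forall k, 0 <= t k.

Lemma normc_disk_sub_le2 (z : C) k : normc z <= 1 -> normc (z - a k) <= 2.
Proof.
move=> z1; apply: (le_trans (normcD_le _ _)).
by rewrite -[- a k]sub0r normcBC subr0 a1; lra.
Qed.

Lemma powR_disk_sub_le (z : C) k : normc z <= 1 -> normc (z - a k) `^ t k <= 2 `^ t k.
Proof.
move=> z1; apply: ge0_ler_powR; rewrite ?nnegrE ?normc_ge0//.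
exact: normc_disk_sub_le2.
Qed.

Lemma modulus_bounded (z : C) : normc z < 1 -> normc (h z) <= M * \prod_(k < n) 2 `^ t k.
Proof.
move=> z1; rewrite hmod// ler_wpM2l//; apply: ler_prod => k _.
by rewrite powR_ge0/= powR_disk_sub_le// ltW.
Qed.

Lemma modulus_cvg0 (k : 'I_n) : 0 < t k -> h @ at_disk (a k) --> (0 : C).
Proof.
move=> tk; apply/cvgC => e e0.
pose B := M * \prod_(j < n | j != k) 2 `^ t j + 1.
have B0 : 0 < B by rewrite ltr_wpDl// mulr_ge0// prodr_ge0// => j _; rewrite powR_ge0.
near=> w; rewrite subr0.
have w1 : normc w < 1 by near: w; exact: near_disk_norm.
have wr : normc (w - a k) < (e / B) `^ (t k)^-1.
  by near: w; apply: near_disk_dist; rewrite powR_gt0// divr_gt0.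
have wt : normc (w - a k) `^ t k < e / B.
  have := gt0_ltr_powR tk _ _ wr; rewrite !nnegrE normc_ge0 powR_ge0 => /(_ isT isT).
  by rewrite /= -powRrM mulVf ?gt_eqF// powRr1// divr_ge0// ltW.
rewrite hmod// (bigD1 k)//= mulrCA mulrC.
apply: (@le_lt_trans _ _ (B * normc (w - a k) `^ t k)); last first.
  by rewrite mulrC -ltr_pdivlMr.
rewrite ler_wpM2r ?powR_ge0// /B.
apply: (@le_trans _ _ (M * \prod_(j < n | j != k) 2 `^ t j)); last by rewrite lerDl.
rewrite ler_wpM2l//; apply: ler_prod => j _.
by rewrite powR_ge0/= powR_disk_sub_le// ltW.
Unshelve. all: by end_near. Qed.

(** Near [z] each [|w - a k|] with [t k > 0] exceeds half of [|z - a k|]. Terms with [t k = 0]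
    vanish, so their [a k] may coincide with [z]. *)
Lemma logder_bounded (z : C) : (forall k, 0 < t k -> a k != z) ->
  \forall w \near at_disk z, normc (logder w) <= \sum_(k < n) t k * (2 / normc (z - a k)).
Proof.
move=> tz.
have : \forall w \near at_disk z, forall k,
    normc ((t k)%:C / (w - a k)) <= t k * (2 / normc (z - a k)).
  apply: filter_forall => k.
  have [tk|tk] := ltP 0 (t k); last first.
    have -> : t k = 0 by apply/eqP; rewrite eq_le tk t0.
    by near=> w; rewrite rmorph0 !mul0r Normc.normc0.
  have zk : 0 < normc (z - a k) by rewrite normc_gt0 subr_eq0 eq_sym tz.
  near=> w.
  have wz : normc (w - z) < normc (z - a k) / 2.
    by near: w; apply: near_disk_dist; rewrite divr_gt0.
  have wk : normc (z - a k) / 2 < normc (w - a k).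
    have := normcD_le (w - a k) (z - w).
    have -> : w - a k + (z - w) = z - a k by ring.
    by rewrite normcBC in wz; lra.
  rewrite Normc.normcM Normc.normcV normc_real ger0_norm// ler_pM2l//.
  rewrite -[2 / _]invrK invf_div lef_pV2 ?posrE//; first exact: ltW.
    by rewrite (lt_trans _ wk)// divr_gt0.
  by rewrite divr_gt0.
apply: filterS => w wk; apply: (le_trans (normc_sum _ _)).
by apply: ler_sum => k _; exact: wk.
Unshelve. all: by end_near. Qed.

(** At a zero the limit is [0]. Elsewhere [h] and [logder] are bounded near [z], so the derivative
    [h * logder] is bounded, and [h] is Lipschitz, hence Cauchy, on the convex intersection of the
    disk with a ball. *)
Lemma modulus_is_cvg (z : C) : normc z <= 1 -> cvg (h @ at_disk z).
Proof.
move=> z1; have FF := at_disk_proper z1.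
have [[k [tk akz]]|tz] := pselect (exists k, 0 < t k /\ a k = z).
  by apply/cvg_ex; exists 0; rewrite -akz; exact: modulus_cvg0.
have {}tz k : 0 < t k -> a k != z by move=> tk; apply/eqP => akz; apply: tz; exists k.
have /at_diskP[r r0 rP] := logder_bounded tz.
set L := \sum_(k < n) _ in rP.
set B := M * \prod_(k < n) 2 `^ t k.
have B0 : 0 <= B by rewrite mulr_ge0// prodr_ge0// => k _; rewrite powR_ge0.
have L0 : 0 <= L by apply: sumr_ge0 => k _; rewrite mulr_ge0// divr_ge0// normc_ge0.
have lip w1 w2 : normc w1 < 1 -> normc w2 < 1 ->
    normc (w1 - z) < r -> normc (w2 - z) < r ->
    normc (h w2 - h w1) <= B * L * normc (w2 - w1).
  move=> w11 w21 w1z w2z.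
  (* One convexity statement for two balls: [b = 0] is the unit disk and [b = 1] the ball around
     [z]. *)
  have cvx (b rho x : R) : 0 <= x <= 1 -> normc (w1 - b%:C * z) < rho ->
      normc (w2 - b%:C * z) < rho -> normc (w1 + x%:C * (w2 - w1) - b%:C * z) < rho.
    move=> /andP[x0 x1] h1 h2.
    have -> : w1 + x%:C * (w2 - w1) - b%:C * z =
       (1 - x)%:C * (w1 - b%:C * z) + x%:C * (w2 - b%:C * z).
      by rewrite rmorphB rmorph1; ring.
    apply: (le_lt_trans (normcD_le _ _)); rewrite !Normc.normcM !normc_real.
    rewrite ger0_norm ?subr_ge0// ger0_norm//.
    apply: (@le_lt_trans _ _ (Num.max (normc (w1 - b%:C * z)) (normc (w2 - b%:C * z)))).
      rewrite -[leRHS]mul1r -[X in _ <= X * _](subrK x 1) [leRHS]mulrDl.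
      by apply: lerD; rewrite ler_wpM2l ?subr_ge0// le_max lexx ?orbT.
    by rewrite gt_max h1.
  have inD x : 0 <= x <= 1 -> normc (w1 + x%:C * (w2 - w1)) < 1.
    by move=> x01; have := cvx 0 1 x x01; rewrite !rmorph0 !mul0r !subr0; exact.
  have inB x : 0 <= x <= 1 -> normc (w1 + x%:C * (w2 - w1) - z) < r.
    by move=> x01; have := cvx 1 r x x01; rewrite !rmorph1 !mul1r; exact.
  apply: (@normc_mean_value R h (fun w => h w * logder w)) => x x01.
    by apply: is_derive_logder; exact: inD.
  rewrite Normc.normcM ler_pM ?normc_ge0//; first by apply: modulus_bounded; exact: inD.
  by apply: rP; [exact: inD|exact: inB].
apply: (@cauchy_cvgC _ _ _ _ _ B).
  by near=> w; apply: modulus_bounded; near: w; exact: near_disk_norm.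
move=> e e0.
pose rho := Num.min r (e / (B * L + 1) / 2).
have BL0 : 0 <= B * L by exact: mulr_ge0.
have BL1 : 0 < B * L + 1 by rewrite ltr_wpDl.
have rho0 : 0 < rho by rewrite lt_min r0/= !divr_gt0.
have rhor : rho <= r by rewrite ge_min lexx.
have rhoe : rho <= e / (B * L + 1) / 2 by rewrite ge_min lexx orbT.
near (at_disk z) => w0.
have w01 : normc w0 < 1 by near: w0; exact: near_disk_norm.
have w0z : normc (w0 - z) < rho by near: w0; exact: near_disk_dist.
exists (h w0); near=> w.
have w1 : normc w < 1 by near: w; exact: near_disk_norm.
have wz : normc (w - z) < rho by near: w; exact: near_disk_dist.
have wr := lt_le_trans wz rhor; have w0r := lt_le_trans w0z rhor.
apply: (le_lt_trans (lip _ _ w01 w1 w0r wr)).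
have ww : normc (w - w0) < e / (B * L + 1).
  have -> : w - w0 = (w - z) + (z - w0) by ring.
  apply: (le_lt_trans (normcD_le _ _)); rewrite [normc (z - _)]normcBC; lra.
apply: (@le_lt_trans _ _ ((B * L + 1) * normc (w - w0))).
  by rewrite ler_wpM2r ?normc_ge0// lerDl.
by rewrite mulrC -ltr_pdivlMr.
Unshelve. all: by end_near. Qed.

(** Used both for [f] and for its quotients by a single [z - a k]; the vanishing at the [a k] with
    positive exponent later singles out the simple zeros. *)
Lemma modulus_extension : exists2 H : C -> C, continuous_extension h H &
  forall k, 0 < t k -> H (a k) = 0.
Proof.
pose H (z : C) : C := if normc z < 1 then h z else lim (h @ at_disk z).
exists H.
  apply: continuous_extension_lim => z z1; first by rewrite /H z1.
  rewrite /H; case: ifPn => [{}z1|_]; last exact: modulus_is_cvg.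
  apply: cvg_at_disk; apply: differentiable_continuous.
  by apply/derivable1_diffP; exact: hder.
move=> k tk; rewrite /H a1 ltxx.
have ak1 : normc (a k) <= 1 by rewrite a1.
have FF := at_disk_proper ak1.
by apply: (@cvg_lim C (@norm_hausdorff _ C)); exact: modulus_cvg0.
Qed.

End PrescribedModulus.

(** * The logarithmic derivative and its derivative on the circle *)

Section LogarithmicDerivative.
Variables (R : realType) (n : nat) (a : 'I_n -> R[i]).
Implicit Type t : 'I_n -> R.
Local Notation normc := (@Normc.normc R).
Local Notation C := (R[i]^o).
Local Notation Re := complex.Re.
Local Notation Im := complex.Im.

Definition dlogder t (z : C) : C := - \sum_(k < n) (t k)%:C / (z - a k) ^+ 2.

Lemma is_derive_invsub (b z : C) : z != b ->
  is_derive z 1 (fun w : C => (w - b)^-1 : C) (- ((z - b) ^+ 2)^-1).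
Proof.
rewrite -subr_eq0 => zb.
have hd := is_derive_subr b z.
have hd1 : derivable (fun w : C => w - b : C) z 1 by exact: (@ex_derive _ _ _ _ _ _ _ hd).
apply: DeriveDef; first exact: derivableV.
rewrite deriveV//.
by rewrite (@derive_val _ _ _ _ _ _ _ hd) /GRing.scale/= mulr1.
Qed.

(** A summand with zero exponent is identically zero, so [z] may equal its [a k]. This permits
    evaluation at a zero of [f] once the factor of that zero has been removed. *)
Lemma is_derive_logder_at t (z : C) : (forall k, t k != 0 -> z != a k) ->
  is_derive z 1 (logder a t : C -> C) (dlogder t z).
Proof.
move=> tz.
have hk (k : 'I_n) : is_derive z 1 (fun w : C => (t k)%:C / (w - a k) : C)
    (- ((t k)%:C / (z - a k) ^+ 2)).
  have [tk|tk] := eqVneq (t k) 0.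
    have -> : (fun w : C => (t k)%:C / (w - a k) : C) = cst 0.
      by apply/funext => w; rewrite tk rmorph0 mul0r.
    by rewrite tk rmorph0 mul0r oppr0; exact: is_derive_cst.
  have := is_deriveZ ((t k)%:C : C) (is_derive_invsub (tz _ tk)).
  by rewrite /GRing.scale/= mulrN.
have := is_derive_sum hk; rewrite /dlogder -sumrN; congr is_derive.
by apply/funext => w; rewrite fct_sumE.
Qed.

Lemma derivable_dlogder t (z : C) : (forall k, t k != 0 -> z != a k) ->
  derivable (dlogder t : C -> C) z 1.
Proof.
move=> tz.
have -> : (dlogder t : C -> C) =
    \sum_(k < n) (fun w : C => - ((t k)%:C / (w - a k) ^+ 2) : C).
  by apply/funext => w; rewrite fct_sumE /dlogder sumrN.
apply: derivable_sum => k.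
have [tk|tk] := eqVneq (t k) 0.
  have -> : (fun w : C => - ((t k)%:C / (w - a k) ^+ 2) : C) = cst 0.
    by apply/funext => w; rewrite tk rmorph0 mul0r oppr0.
  exact: derivable_cst.
have -> : (fun w : C => - ((t k)%:C / (w - a k) ^+ 2) : C) =
    (- (t k)%:C : C) *:
    ((fun w : C => (w - a k)^-1 : C) * (fun w : C => (w - a k)^-1 : C)).
  by apply/funext => w; rewrite !fctE /GRing.scale/= -mulNr expr2 invfM.
have hd := is_derive_invsub (tz _ tk).
by apply: derivableZ; apply: derivableM; exact: (@ex_derive _ _ _ _ _ _ _ hd).
Qed.

Lemma continuous_derivable (g : C -> C) (z : C) :
  derivable g z 1 -> {for z, continuous g}.
Proof. by move=> /derivable1_diffP; exact: differentiable_continuous. Qed.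

Lemma cvg_logder t (z : C) : (forall k, t k != 0 -> z != a k) ->
  (logder a t : C -> C) @ at_disk z --> (logder a t z : C).
Proof.
move=> tz; apply: cvg_at_disk; apply: continuous_derivable.
exact: (@ex_derive _ _ _ _ _ _ _ (is_derive_logder_at tz)).
Qed.

Lemma cvg_dlogder t (z : C) : (forall k, t k != 0 -> z != a k) ->
  (dlogder t : C -> C) @ at_disk z --> (dlogder t z : C).
Proof.
by move=> tz; apply: cvg_at_disk; apply: continuous_derivable; exact: derivable_dlogder.
Qed.

(** Since [z / (z - b) - 1 = b / (z - b)], the ratio is equidistant from [0] and [1]. *)
Lemma Re_unit_ratio (z b : C) : normc z = 1 -> normc b = 1 -> z != b ->
  Re (z / (z - b)) = 1 / 2.
Proof.
move=> z1 b1; rewrite -subr_eq0 => zb.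
have : normc (z / (z - b)) ^+ 2 = normc (z / (z - b) - 1) ^+ 2.
  have -> : z / (z - b) - 1 = b / (z - b) by field.
  by rewrite !Normc.normcM z1 b1.
by rewrite !sqr_normcE; case: (z / (z - b)) => x y /=; lra.
Qed.

Lemma Re_mul_logder t (z : C) : (forall k, normc (a k) = 1) -> normc z = 1 ->
  (forall k, t k != 0 -> z != a k) -> Re (z * logder a t z) = (\sum_(k < n) t k) / 2.
Proof.
move=> a1 z1 tz; rewrite mulr_sumr Re_sum mulr_suml; apply: eq_bigr => k _.
have [->|tk] := eqVneq (t k) 0; first by rewrite rmorph0 mul0r mulr0 mul0r.
by rewrite mulrCA ReZ Re_unit_ratio ?tz// mul1r.
Qed.

(** With [L = z * logder], the left side is [z L']. For [q = z / (z - a k)] each summand is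
    [t k * q * (1 - q)], and [Re q = 1 / 2] makes [1 - q] the conjugate of [q]; hence [z L'] is
    real. *)
Lemma mul_dlogder t (z : C) : (forall k, normc (a k) = 1) -> normc z = 1 ->
  (forall k, t k != 0 -> z != a k) ->
  z * logder a t z + z ^+ 2 * dlogder t z =
    (\sum_(k < n) t k * normc (z / (z - a k)) ^+ 2)%:C.
Proof.
move=> a1 z1 tz; rewrite rmorph_sum /dlogder mulrN !mulr_sumr -sumrB.
apply: eq_bigr => k _.
have [->|tk] := eqVneq (t k) 0; first by rewrite rmorph0 !mul0r !mulr0 subrr rmorph0.
transitivity ((t k)%:C * (z / (z - a k) * (z / (z - a k))^*)); last first.
  by rewrite conj_normc -rmorphM.
have -> : z * ((t k)%:C / (z - a k)) - z ^+ 2 * ((t k)%:C / (z - a k) ^+ 2) =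
  (t k)%:C * (z / (z - a k) * (1 - z / (z - a k))).
  by field; rewrite subr_eq0 tz.
have := Re_unit_ratio z1 (a1 k) (tz k tk).
case: (z / (z - a k)) => x y /= xE; congr (_ * (_ * _)).
by apply/eqP; rewrite eq_complex/=; apply/andP; split; apply/eqP; lra.
Qed.

End LogarithmicDerivative.

(** * Boundary values of [f] and [f'] and the two inequalities between them *)

Section SharpBernstein.
Variables (R : realType) (n : nat) (a : 'I_n -> R[i]) (s : 'I_n -> R).
Local Notation normc := (@Normc.normc R).
Local Notation C := (R[i]^o).
Local Notation Re := complex.Re.
Local Notation Im := complex.Im.
Variables (f : C -> C) (M : R).
Hypothesis a1 : forall k, normc (a k) = 1.
Hypothesis s1 : forall k, 1 <= s k.
Hypothesis fder : forall z : C, normc z < 1 -> derivable f z 1.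
Hypothesis M0 : 0 <= M.
Hypothesis fmod : forall z : C, normc z < 1 ->
  normc (f z) = M * \prod_(k < n) normc (z - a k) `^ s k.

Let s_gt0 k : 0 < s k.
Proof. exact: lt_le_trans ltr01 (s1 k). Qed.

Let disk_neq (z : C) k : normc z < 1 -> z != a k.
Proof. by move=> z1; rewrite -subr_eq0; exact: disk_sub_neq0. Qed.

Definition quotient_exponent (k j : 'I_n) : R := s j - (j == k)%:R.

(** Here [1 <= s k] enters: dividing [f] by one factor [z - a k] leaves nonnegative exponents, so
    the quotient also extends to the closed disk. *)
Lemma quotient_exponent_ge0 k j : 0 <= quotient_exponent k j.
Proof.
rewrite /quotient_exponent subr_ge0; apply: le_trans (s1 j).
by case: (j == k).
Qed.

Definition quotient_at (k : 'I_n) (z : C) : C := f z / (z - a k).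

Lemma derivable_quotient_at k (z : C) : normc z < 1 -> derivable (quotient_at k) z 1.
Proof.
move=> z1; have hd := is_derive_invsub (disk_neq k z1).
apply: (@derivableM _ _ f (fun w : C => (w - a k)^-1 : C)); first exact: fder.
exact: (@ex_derive _ _ _ _ _ _ _ hd).
Qed.

Lemma quotient_modulus k (z : C) : normc z < 1 ->
  normc (quotient_at k z) = M * \prod_(j < n) normc (z - a j) `^ quotient_exponent k j.
Proof.
move=> z1; rewrite Normc.normcM Normc.normcV fmod// -mulrA; congr (_ * _).
rewrite (bigD1 k)// [in RHS](bigD1 k)//= mulrAC; congr (_ * _); last first.
  by apply: eq_bigr => j /negbTE jk; rewrite /quotient_exponent jk subr0.
have zk : 0 < normc (z - a k) by exact: normc_disk_sub_gt0.
rewrite /quotient_exponent eqxx powRB; last by apply/implyP => _; rewrite gt_eqF.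
by rewrite powRr1// ltW.
Qed.

Lemma at_disk_cvg_sum (z : C) (g : 'I_n -> C -> C) (l : 'I_n -> C) :
  (forall k, g k @ at_disk z --> l k) ->
  (fun w => \sum_(k < n) g k w) @ at_disk z --> (\sum_(k < n) l k : C).
Proof.
move=> gl; elim: (index_enum _) => [|k r IH].
  have -> : (fun w => \sum_(k <- [::]) g k w) = (fun=> 0).
    by apply/funext => w; rewrite big_nil.
  by rewrite big_nil; exact: at_disk_cvg_cst.
have -> : (fun w => \sum_(j <- k :: r) g j w) = (fun w => g k w + \sum_(j <- r) g j w).
  by apply/funext => w; rewrite big_cons.
by rewrite big_cons; exact: at_disk_cvgD (gl k) IH.
Qed.

Variables (F : C -> C) (Q : 'I_n -> C -> C).
Hypothesis Fext : continuous_extension f F.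
Hypothesis Qext : forall k, continuous_extension (quotient_at k) (Q k).
Hypothesis Q0 : forall k j, 0 < quotient_exponent k j -> Q k (a j) = 0.

(** The boundary values of [f'], written through the extended quotients [f / (z - a k)] because
    [logder] has poles at the [a k]. *)
Definition dF (z : C) : C := \sum_(k < n) (s k)%:C * Q k z.

Let S := \sum_(k < n) s k.

Lemma f_logder (z : C) : f z * logder a s z = \sum_(k < n) (s k)%:C * quotient_at k z.
Proof.
by rewrite mulr_sumr; apply: eq_bigr => k _; rewrite mulrCA.
Qed.

Lemma dF_cvg (z : C) : normc z <= 1 ->
  (fun w => f w * logder a s w) @ at_disk z --> (dF z : C).
Proof.
move=> z1; under eq_fun do rewrite f_logder.
apply: at_disk_cvg_sum => k; apply: at_disk_cvgM; first exact: at_disk_cvg_cst.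
exact: (continuous_extension_cvg (Qext k) z1).
Qed.

Lemma dF_ext : continuous_extension (cderiv f) dF.
Proof.
have fE (z : C) : normc z < 1 -> f z * logder a s z = cderiv f z.
  move=> z1; have h := is_derive_logder a1 fder M0 fmod z1.
  by rewrite /cderiv derive1E (@derive_val _ _ _ _ _ _ _ h).
apply: continuous_extension_lim => z z1; last exact: at_disk_cvg_eq fE (dF_cvg z1).
rewrite -fE// f_logder; apply: eq_bigr => k _; congr (_ * _).
by apply: (Qext k).1; rewrite normc_lt1.
Qed.

(** The identity holds by definition inside the disk and passes to the boundary by uniqueness of
    limits. *)
Lemma sub_mul_Q k (z : C) : normc z <= 1 -> (z - a k) * Q k z = F z.
Proof.
move=> z1; apply: (at_disk_lim_unique z1 _ (continuous_extension_cvg Fext z1)).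
have fE (w : C) : normc w < 1 -> (w - a k) * quotient_at k w = f w.
  by move=> w1; rewrite /quotient_at mulrC divfK// disk_sub_neq0.
apply: at_disk_cvg_eq fE _; apply: at_disk_cvgM; last first.
  exact: (continuous_extension_cvg (Qext k) z1).
exact: at_disk_cvgB (at_disk_cvg_id z) (at_disk_cvg_cst z (a k)).
Qed.

Lemma F_root k : F (a k) = 0.
Proof. by rewrite -(sub_mul_Q k) ?a1// subrr mul0r. Qed.

Lemma dF_logder (z : C) : normc z <= 1 -> (forall k, z != a k) ->
  dF z = F z * logder a s z.
Proof.
move=> z1 za; rewrite /dF /logder mulr_sumr; apply: eq_bigr => k _.
by rewrite -(sub_mul_Q k z1) mulrCA [(z - _) * _]mulrC mulfK// subr_eq0.
Qed.

(** These are the multiple zeros, the points [a j] not being assumed distinct: every quotient keeps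
    a positive exponent at the point [a k]. *)
Lemma dF_root k : (1 < s k \/ exists2 j, j != k & a j = a k) -> dF (a k) = 0.
Proof.
move=> sk; rewrite /dF big1// => i _.
suff -> : Q i (a k) = 0 by rewrite mulr0.
have [ik|ik] := eqVneq i k; last first.
  by apply: Q0; rewrite /quotient_exponent eq_sym (negbTE ik) subr0.
case: sk => [sk|[j jk <-]]; apply: Q0; rewrite /quotient_exponent ik.
  by rewrite eqxx subr_gt0.
by rewrite (negbTE jk) subr0.
Qed.

Lemma dF_simple_root k : s k = 1 -> dF (a k) = Q k (a k).
Proof.
move=> sk; rewrite /dF (bigD1 k)//= big1 ?addr0 ?sk ?mul1r// => i ik.
by rewrite Q0 ?mulr0// /quotient_exponent eq_sym (negbTE ik) subr0.
Qed.

(** * The polar derivative and the location of its maximum *)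

Section PolarDerivative.
Variables (sigma B : R).
Hypothesis sigmaS : S < sigma.
Hypothesis FB : forall z : C, normc z = 1 -> normc (F z) <= B.

Let S_ge0 : 0 <= S.
Proof. by apply: sumr_ge0 => k _; exact: ltW. Qed.

Let B_ge0 : 0 <= B.
Proof. by apply: le_trans (FB (@Normc.normc1 R)); exact: normc_ge0. Qed.

(** For a polynomial [f] of degree [sigma] this is the polar derivative with pole [0]. *)
Definition polar (z : C) : C := sigma%:C * f z - z * (f z * logder a s z).

Definition polarF (z : C) : C := sigma%:C * F z - z * dF z.

Definition dpolar (z : C) : C := f z * ((sigma - 1)%:C * logder a s z
  - z * (logder a s z * logder a s z + dlogder a s z)).

Lemma polar_cvg (z : C) : normc z <= 1 -> polar @ at_disk z --> (polarF z : C).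
Proof.
move=> z1.
have hF := at_disk_cvgM (at_disk_cvg_cst z sigma%:C) (continuous_extension_cvg Fext z1).
exact: at_disk_cvgB hF (at_disk_cvgM (at_disk_cvg_id z) (dF_cvg z1)).
Qed.

Lemma polar_ext : continuous_extension polar polarF.
Proof.
apply: continuous_extension_lim => z z1; last exact: polar_cvg.
rewrite /polarF /polar Fext.1 ?normc_lt1// f_logder; congr (_ - _ * _).
by apply: eq_bigr => k _; rewrite (Qext k).1// normc_lt1.
Qed.

Lemma is_derive_polar (z : C) : normc z < 1 -> is_derive z 1 polar (dpolar z).
Proof.
move=> z1; have hf := is_derive_logder a1 fder M0 fmod z1.
have hL := is_derive_logder_at (fun k (_ : s k != 0) => disk_neq k z1).
have hfL := is_deriveM hf hL.
have h := is_deriveB (is_deriveZ (sigma%:C : C) hf)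
  (is_deriveM (is_derive_id z (1 : C)) hfL).
apply: is_derive_eq h _; rewrite /dpolar /GRing.scale/= fctE rmorphB rmorph1.
by ring.
Qed.

Lemma derivable_dpolar (z : C) : normc z < 1 -> derivable (dpolar : C -> C) z 1.
Proof.
move=> z1; have hL := is_derive_logder_at (fun k (_ : s k != 0) => disk_neq k z1).
have hL1 := @ex_derive _ _ _ _ _ _ _ hL.
have hL2 := derivable_dlogder (fun k (_ : s k != 0) => disk_neq k z1).
have hA := derivableM (derivable_cst ((sigma - 1)%:C : C) z (1 : C)) hL1.
have hB := derivableD (derivableM hL1 hL1) hL2.
have hC := derivableM (@derivable_id _ C z 1) hB.
exact: (derivableM (fder z1) (derivableB hA hC)).
Qed.

Lemma polar_max : exists2 z0 : C, normc z0 = 1 &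
  forall z : C, normc z <= 1 -> normc (polarF z) <= normc (polarF z0).
Proof.
have hdd (z : C) : normc z < 1 ->
    is_derive z 1 (dpolar : C -> C) ('D_1 (dpolar : C -> C) z).
  by move=> z1; apply: DeriveDef => //; exact: derivable_dpolar.
have [z0 /normc_eq1 z01 z0m] := maximum_modulus is_derive_polar hdd polar_ext.
by exists z0.
Qed.

(** Away from the zeros, the condition of [boundary_max] leaves only the case where
    [L = z0 * logder] is real, and then [sigma - L = sigma - S / 2]. *)
Lemma polar_max_regular (z0 : C) : normc z0 = 1 ->
  (forall z : C, normc z <= 1 -> normc (polarF z) <= normc (polarF z0)) ->
  (forall k, z0 != a k) -> normc (polarF z0) <= (sigma - S / 2) * B.
Proof.
move=> z01 z0m za.
have z01' : normc z0 <= 1 by rewrite z01.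
have za' k : s k != 0 -> z0 != a k by [].
have hdp : dpolar @ at_disk z0 --> (F z0 * ((sigma - 1)%:C * logder a s z0
  - z0 * (logder a s z0 * logder a s z0 + dlogder a s z0)) : C).
  have hF := continuous_extension_cvg Fext z01'.
  have hL := cvg_logder za'; have hL2 := cvg_dlogder za'.
  have h1 := at_disk_cvgD (at_disk_cvgM hL hL) hL2.
  have h2 := at_disk_cvgB (at_disk_cvgM (at_disk_cvg_cst z0 (sigma - 1)%:C) hL)
    (at_disk_cvgM (at_disk_cvg_id z0) h1).
  exact: at_disk_cvgM hF h2.
have pm z : normc z < 1 -> normc (polar z) <= normc (polarF z0).
  move=> z1; rewrite -(polar_ext.1 z); last by rewrite normc_lt1.
  by apply: z0m; rewrite ltW.
have [W1 W2] := boundary_max is_derive_polar z01 (polar_cvg z01') hdp pm.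
have sS : 0 < sigma - S / 2 by move: sigmaS S_ge0; lra.
have [F0|F0] := eqVneq (F z0) 0.
  rewrite /polarF dF_logder// F0 mul0r !mulr0 subrr Normc.normc0.
  by rewrite mulr_ge0// ltW.
pose L := z0 * logder a s z0.
have LR : Re L = S / 2 by exact: Re_mul_logder.
set D := \sum_(k < n) s k * normc (z0 / (z0 - a k)) ^+ 2.
have LD : L + z0 ^+ 2 * dlogder a s z0 = D%:C by exact: mul_dlogder.
have pE : polarF z0 = F z0 * (sigma%:C - L).
  by rewrite /polarF dF_logder// /L; ring.
(* Substituting [z0 ^+ 2 * dlogder = D - L] with [D] real isolates [L] as the only non-real
   quantity. *)
have WE : (polarF z0)^* * (F z0 * ((sigma - 1)%:C * logder a s z0
  - z0 * (logder a s z0 * logder a s z0 + dlogder a s z0))) * z0 =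
  (normc (F z0) ^+ 2)%:C * ((sigma%:C - L)^* * (L * (sigma%:C - L) - D%:C)).
  rewrite pE rmorphM -conj_normc -LD (rmorphB _ sigma) rmorph1.
  by move: (conjc (sigma%:C - L)) => cj; rewrite /L; ring.
move: W1 W2; rewrite WE ReZ ImZ.
have FF : 0 < normc (F z0) ^+ 2 by rewrite exprn_gt0// normc_gt0.
move=> /eqP; rewrite mulf_eq0 gt_eqF//= => /eqP; rewrite pmulr_rge0//.
have LI : Im L = 0 -> normc (polarF z0) <= (sigma - S / 2) * B.
  move=> L0; rewrite pE Normc.normcM mulrC.
  have -> : sigma%:C - L = (sigma - S / 2)%:C.
    rewrite -LR; move: L0; case: (L) => x y /= ->.
    by apply/eqP; rewrite eq_complex/= subr0 !eqxx.
  by rewrite normc_real gtr0_norm// ler_wpM2l ?FB// ltW.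
move: LI LR; case: (L) => x y /= LI xE W1 W2.
apply: LI; apply/eqP; rewrite -[_ == _]negbK; apply/negP => y0.
(* For [y != 0] the vanishing imaginary part gives [D = |sigma - L|^2]. With [x = S / 2] the real
   part becomes [|sigma - L|^2 * (S - sigma)], which is negative. *)
have h : (sigma - x) ^+ 2 + y ^+ 2 = D.
  by apply: (mulIf y0); move: W1; rewrite !subr0 !sub0r => W1; lra.
have : 0 <= ((sigma - x) ^+ 2 + y ^+ 2) * (S - sigma).
  by move: W2; rewrite xE !subr0 !sub0r in h * => W2; rewrite -h in W2; lra.
rewrite nmulr_lge0; last by rewrite subr_lt0.
by apply/negP; rewrite -ltNge ltr_pwDl ?exprn_gt0 ?sqr_ge0// xE.
Qed.

(** At a multiple zero [dF] vanishes. At a simple zero the boundary condition reads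
    [0 <= |q|^2 * (S - sigma)] with [q = Q k (a k)], so [q = 0]. *)
Lemma polar_max_root k :
  (forall z : C, normc z <= 1 -> normc (polarF z) <= normc (polarF (a k))) ->
  polarF (a k) = 0.
Proof.
move=> z0m.
have ak1 : normc (a k) <= 1 by rewrite a1.
have pE : polarF (a k) = - (a k * dF (a k)) by rewrite /polarF F_root mulr0 sub0r.
have [sk|sk1] := ltP 1 (s k); first by rewrite pE dF_root ?mulr0 ?oppr0//; left.
have {}sk1 : s k = 1 by apply/eqP; rewrite eq_le sk1 s1.
have [[j [jk ajk]]|aj] := pselect (exists j, j != k /\ a j = a k).
  by rewrite pE dF_root ?mulr0 ?oppr0//; right; exists j.
(* Removing the exponent of [a k] leaves a logarithmic derivative that is regular at [a k]. *)
pose t j := if j == k then 0 else s j.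
have ta j : t j != 0 -> a k != a j.
  rewrite /t; case: ifPn => [_|jk _]; first by rewrite eqxx.
  by apply/eqP => ajk; apply: aj; exists j; split=> //.
have logderE (w : C) : w != a k -> logder a s w = (w - a k)^-1 + logder a t w.
  move=> wk; rewrite /logder (bigD1 k)//= [in RHS](bigD1 k)//=.
  rewrite /t eqxx sk1 rmorph0 rmorph1 mul1r mul0r add0r; congr (_ + _).
  by apply: eq_bigr => j /negbTE ->.
have dlogderE (w : C) : w != a k -> dlogder a s w = - ((w - a k) ^+ 2)^-1 + dlogder a t w.
  move=> wk; rewrite /dlogder (bigD1 k)//= [in RHS](bigD1 k)//=.
  rewrite /t eqxx sk1 rmorph0 rmorph1 mul1r mul0r add0r opprD; congr (_ - _).
  by apply: eq_bigr => j /negbTE ->.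
(* This is [dpolar] divided by [quotient_at k]: the double poles of [logder ^+ 2] and [dlogder] at
   [a k] cancel, and the factor [w - a k] of [f] absorbs the simple ones. *)
pose r (w : C) : C := (sigma - 1)%:C * (1 + (w - a k) * logder a t w)
  - w * (logder a t w + logder a t w
         + (w - a k) * (logder a t w * logder a t w + dlogder a t w)).
have dpE (w : C) : normc w < 1 -> quotient_at k w * r w = dpolar w.
  move=> w1; have wk := disk_neq k w1; have wk0 : w - a k != 0 by rewrite subr_eq0.
  by rewrite /dpolar /quotient_at /r logderE// dlogderE//; field.
have hr : r @ at_disk (a k) --> (r (a k) : C).
  have hL := cvg_logder ta; have hL2 := cvg_dlogder ta.
  have hw := at_disk_cvgB (at_disk_cvg_id (a k)) (at_disk_cvg_cst (a k) (a k)).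
  have hLL := at_disk_cvgD (at_disk_cvgM hL hL) hL2.
  have h1 := at_disk_cvgD (at_disk_cvg_cst (a k) 1) (at_disk_cvgM hw hL).
  have h2 := at_disk_cvgD (at_disk_cvgD hL hL) (at_disk_cvgM hw hLL).
  exact: at_disk_cvgB (at_disk_cvgM (at_disk_cvg_cst _ (sigma - 1)%:C) h1)
    (at_disk_cvgM (at_disk_cvg_id _) h2).
have hdp : dpolar @ at_disk (a k) --> (Q k (a k) * r (a k) : C).
  apply: at_disk_cvg_eq dpE _; apply: (at_disk_cvgM _ hr).
  exact: (continuous_extension_cvg (Qext k) ak1).
have pm z : normc z < 1 -> normc (polar z) <= normc (polarF (a k)).
  move=> z1; rewrite -(polar_ext.1 z); last by rewrite normc_lt1.
  by apply: z0m; rewrite ltW.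
have [_ W2] := boundary_max is_derive_polar (a1 k) (polar_cvg ak1) hdp pm.
pose q := Q k (a k).
have dFq : dF (a k) = q by exact: dF_simple_root.
have -> : polarF (a k) = - (a k * q) by rewrite pE dFq.
have akk : (a k)^* * a k = 1 by rewrite mulrC conj_normc a1 expr1n rmorph1.
have WE : (polarF (a k))^* * (q * r (a k)) * a k =
    (normc q ^+ 2)%:C *
    ((1 - sigma)%:C + (a k * logder a t (a k)) + (a k * logder a t (a k))).
  rewrite pE dFq rmorphN rmorphM -conj_normc /r subrr !mul0r !addr0 mulr1.
  rewrite -[RHS]mul1r -akk (rmorphB _ sigma) (rmorphB _ 1 sigma) rmorph1.
  by ring.
move: W2; rewrite WE ReZ !ReD (Re_mul_logder a1 (a1 k) ta) /=.
have -> : \sum_(j < n) t j = S - 1.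
  rewrite /S (bigD1 k)//= [in RHS](bigD1 k)//= /t eqxx sk1 add0r.
  rewrite [1 + _]addrC addrK.
  by apply: eq_bigr => j /negbTE ->.
have -> : 1 - sigma + (S - 1) / 2 + (S - 1) / 2 = S - sigma by field.
rewrite nmulr_lge0; last by rewrite subr_lt0.
rewrite exprn_even_le0//= normc_eq0 => /eqP ->.
by rewrite mulr0 oppr0.
Qed.

Lemma polarF_le (z : C) : normc z <= 1 -> normc (polarF z) <= (sigma - S / 2) * B.
Proof.
move=> z1; have [z0 z01 z0m] := polar_max.
apply: (le_trans (z0m z z1)).
have [[k ak]|za] := pselect (exists k, z0 = a k); last first.
  by apply: polar_max_regular => // k; apply/eqP => zk; apply: za; exists k.
rewrite ak in z0m *; rewrite polar_max_root// Normc.normc0 mulr_ge0//.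
by move: sigmaS S_ge0; lra.
Qed.

(** Off the zeros [L = z * logder] has real part [S / 2 < sigma / 2], so it is nearer to [0] than to
    [sigma]. At a zero both sides agree because [F] vanishes. *)
Lemma dF_le_polarF (z : C) : normc z = 1 -> normc (dF z) <= normc (polarF z).
Proof.
move=> z1; have [[k ->]|za] := pselect (exists k, z = a k).
  by rewrite /polarF F_root mulr0 sub0r -[- _]sub0r normcBC subr0 Normc.normcM a1 mul1r.
have {}za k : z != a k by apply/eqP => zk; apply: za; exists k.
have LR : Re (z * logder a s z) = S / 2 by exact: Re_mul_logder.
have -> : normc (dF z) = normc (F z) * normc (z * logder a s z).
  by rewrite dF_logder ?z1// !Normc.normcM z1 mul1r.
have -> : polarF z = F z * (sigma%:C - z * logder a s z).
  by rewrite /polarF dF_logder ?z1//; ring.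
rewrite [leRHS]Normc.normcM ler_wpM2l ?normc_ge0//.
rewrite -(ler_pXn2r (_ : 0 < 2)%N) ?nnegrE ?normc_ge0// !sqr_normcE.
move: LR; case: (_ * logder _ _ _) => x y /= ->.
by move: sigmaS S_ge0; nra.
Qed.

End PolarDerivative.

(** The modulus of [z * logder] is at least its real part [S / 2]. *)
Lemma dF_ge (z : C) : normc z = 1 -> S / 2 * normc (F z) <= normc (dF z).
Proof.
move=> z1; have [[k ->]|za] := pselect (exists k, z = a k).
  by rewrite F_root Normc.normc0 mulr0 normc_ge0.
have {}za k : z != a k by apply/eqP => zk; apply: za; exists k.
rewrite dF_logder ?z1// Normc.normcM mulrC ler_wpM2l ?normc_ge0//.
have -> : S / 2 = Re (z * logder a s z) by rewrite Re_mul_logder.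
apply: (le_trans (ler_norm _)); apply: (le_trans (Re_le_normc _)).
by rewrite Normc.normcM z1 mul1r.
Qed.

Lemma dF_le (B : R) (z : C) : (forall w : C, normc w = 1 -> normc (F w) <= B) ->
  normc z = 1 -> normc (dF z) <= S / 2 * B.
Proof.
move=> FB z1.
have B0 : 0 <= B by apply: le_trans (FB _ z1); exact: normc_ge0.
apply/ler_addgt0Pr => e e0.
(* With [sigma = S + d] the bound is [(S / 2 + d) * B], and [d * B <= d * (B + 1) = e]. *)
pose d := e / (B + 1).
have B1 : 0 < B + 1 by lra.
have d0 : 0 < d by exact: divr_gt0.
have sig : S < S + d by rewrite ltrDl.
apply: (le_trans (dF_le_polarF sig z1)).
have z1' : normc z <= 1 by rewrite z1.
apply: (le_trans (polarF_le sig FB z1')).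
have : d * (B + 1) = e by rewrite /d divfK// gt_eqF.
by move: (S) d0 => S'; nra.
Qed.

Lemma sup_norm_dF : 0 < S ->
  sup_norm (@unit_circle R) dF = S / 2 * sup_norm (@unit_circle R) F.
Proof.
move=> Sgt0.
pose m := sup_norm (@unit_circle R) F.
have Fm (z : C) : normc z = 1 -> normc (F z) <= m.
  move=> z1; apply: ub_le_sup; last by exists z => //; apply/normc_eq1.
  (* The supremum dominates the values only for a set bounded above; the bound on [f] inside the
     disk passes to its boundary values. *)
  exists (M * \prod_(k < n) 2 `^ s k) => _ [w /normc_eq1 w1 <-].
  have w1' : normc w <= 1 by rewrite w1.
  apply: (at_disk_cvg_normc_le w1' _ (continuous_extension_cvg Fext w1')).
  by move=> v v1; apply: (modulus_bounded a1 M0 fmod) => // k; exact: ltW.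
have dFm := dF_le Fm.
have hdF (z : C) : normc z = 1 -> normc (dF z) <= sup_norm (@unit_circle R) dF.
  move=> z1; apply: ub_le_sup; last by exists z => //; apply/normc_eq1.
  by exists (S / 2 * m) => _ [w /normc_eq1 w1 <-]; exact: dFm.
apply/eqP; rewrite eq_le; apply/andP; split.
  apply: ge_sup; first by exists (Re `|dF 1|), 1 => //; exact: unit_circle1.
  by move=> _ [w /normc_eq1 w1 <-]; exact: dFm.
rewrite mulrC -ler_pdivlMr ?divr_gt0//.
apply: ge_sup; first by exists (Re `|F 1|), 1 => //; exact: unit_circle1.
move=> _ [w /normc_eq1 w1 <-]; rewrite ler_pdivlMr ?divr_gt0// mulrC.
by apply: le_trans (hdF _ w1); exact: dF_ge.
Qed.

End SharpBernstein.

(** * Moduli of complex powers and the conclusion *)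

Lemma normc_cexp (R : realType) (z : R[i]) : Normc.normc (cexp z) = expR (complex.Re z).
Proof.
rewrite /cexp /= !exprMn -mulrDr cos2Dsin2 mulr1 sqrtr_sqr.
by apply: ger0_norm; exact: expR_ge0.
Qed.

(** Logarithms of [w] differ only in their imaginary parts, which do not affect the modulus for a
    real exponent; hence no branch has to be fixed. *)
Lemma normc_cpow_values (R : realType) (w v : R[i]) (s : R) :
  cpow_values w s v -> Normc.normc v = Normc.normc w `^ s.
Proof.
move=> [l <- <-]; rewrite !normc_cexp ReZ /powR gt_eqF ?expR_gt0//.
by rewrite expRK.
Qed.

Theorem theorem4 (R : realType) (N : nat) (c : R[i]) (alpha s : 'I_N -> R)
    (p : 'I_N -> R[i] -> R[i]) (f : R[i] -> R[i])
    (hN : (1 <= N)%N)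
    (halpha : forall k, 0 <= alpha k < 2 * pi)
    (hs : forall k, 1 <= s k)
    (hp : forall k z, open_disk z ->
      cpow_values (z - cexp (0 +i* alpha k)) (s k) (p k z))
    (hf : forall z, open_disk z -> f z = c * \prod_(k < N) p k z)
    (hfan : analytic_on (@open_disk R) f) :
  exists F F' : R[i] -> R[i],
    [/\ continuous_extension f F,
        continuous_extension (cderiv f) F' &
        sup_norm (@unit_circle R) F' =
          (\sum_(k < N) s k) / 2 * sup_norm (@unit_circle R) F].
Proof.
pose a k := cexp (0 +i* alpha k).
have a1 k : Normc.normc (a k) = 1 by rewrite normc_cexp expR0.
have fder (z : R[i]^o) : Normc.normc z < 1 -> derivable (f : R[i]^o -> R[i]^o) z 1.
  by move=> z1; apply: hfan; rewrite normc_lt1.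
have M0 := normc_ge0 c.
have fmod (z : R[i]^o) : Normc.normc z < 1 ->
    Normc.normc (f z) = Normc.normc c * \prod_(k < N) Normc.normc (z - a k) `^ s k.
  move=> z1; rewrite hf ?normc_lt1// Normc.normcM normc_prod; congr (_ * _).
  by apply: eq_bigr => k _; apply: normc_cpow_values; apply: hp; rewrite normc_lt1.
have s0 k : 0 <= s k by exact: le_trans ler01 (hs k).
have [F Fext _] := modulus_extension a1 fder M0 fmod s0.
(* Each quotient [f / (z - a k)] again has prescribed modulus, with the exponent at [k] lowered by
   one, so it extends by the same lemma as [f]. *)
have qext k : exists Qk : R[i]^o -> R[i]^o,
    continuous_extension (quotient_at a f k) Qk /\
    (forall j, 0 < quotient_exponent s k j -> Qk (a j) = 0).
  have [Qk Qext Q0] := modulus_extension a1 (@derivable_quotient_at _ _ _ _ a1 fder k) M0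
    (quotient_modulus a1 fmod k) (quotient_exponent_ge0 hs k).
  by exists Qk.
have [Q hQ] := choice qext.
have Qext k := (hQ k).1; have Q0 k := (hQ k).2.
have FQ := sup_norm_dF a1 hs fder M0 fmod Fext Qext Q0.
have dFQ := dF_ext a1 fder M0 fmod Qext.
exists F, (dF s Q); split; [exact: Fext|exact: dFQ|apply: FQ].
(* The sum of exponents is positive because [1 <= N] provides the index [0], whose exponent is at
   least [1]. *)
apply: lt_le_trans (ltr01) _; apply: (le_trans (hs (Ordinal hN))).
by rewrite (bigD1 (Ordinal hN))//= lerDl sumr_ge0.
Qed.
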